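(* Let $r\geq 1$, let $\mathbf{f}=(f_0,f_1,\ldots,f_r)$ with each $f_j\in\mathcal{S}_1$, and let $\boldsymbol{\nu}=(\nu_0,\ldots,\nu_r)$ be a vector of pairwise distinct and pairwise coprime positive integers. Then $$\mathcal{R}_{\mathbf{f}}(\boldsymbol{\nu}) = -\Delta \mathbf{f} + \sum_{k=0}^{r} \nu_k \int_{0}^1 f_k'(\nu_k x)\prod_{j\neq k} f_j(\nu_j x)\, dx .$$
   Context: $\mathcal{S}_1$ denotes the set of functions $f:\mathbb{R}\to\mathbb{C}$ that are $1$-periodic, have discontinuities at most at the integers, and are absolutely continuous on $(0,1)$; for such $f$ the one-sided limits $f(0^+)$, $f(1^-)$ exist, and $f'$ denotes its derivative (defined almost everywhere). For $\mathbf{f}$ and $\boldsymbol{\nu}$ as in the claim, the Dedekind sums are $S_{\mathbf{f}}(\boldsymbol{\nu}\mid\nu_k)=\sum_{i=1}^{\nu_k-1}\prod_{j\neq k} f_j\!\left(\frac{i\nu_j}{\nu_k}\right)$ for $k=0,\ldots,r$. Set $\Delta f_j := f_j(1^-)-f_j(0^+)$, $\Delta\mathbf{f}:=\prod_{j=0}^r f_j(1^-)-\prod_{j=0}^r f_j(0^+)$, and define the reciprocity $\mathcal{R}_{\mathbf{f}}(\boldsymbol{\nu}):=\sum_{k=0}^r S_{\mathbf{f}}(\boldsymbol{\nu}\mid\nu_k)\,\Delta f_k$. *)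

(* Defs.v *)
From HB Require Import structures.
From mathcomp Require Import all_boot all_order all_algebra.
From mathcomp Require Import complex.
From mathcomp Require Import all_classical all_reals all_analysis.

Set Implicit Arguments.
Unset Strict Implicit.
Unset Printing Implicit Defensive.

Import Order.TTheory GRing.Theory Num.Theory.
Import numFieldNormedType.Exports.

Local Open Scope classical_set_scope.
Local Open Scope ring_scope.
Local Open Scope complex_scope.

(* The epsilon-delta definition over finite families of non-overlapping
   intervals with endpoints in I.  The bound is uniform on I: for I = ]0, 1[ this
   is stronger than absolute continuity on every compact subinterval, and
   it is what makes the one-sided limits at 0 and 1 exist. *)
Definition absolutely_continuous_on (R : realType) (I : set R)
    (f : R -> R[i]) : Prop :=
  forall e : R, 0 < e -> exists2 d : R, 0 < d &
    forall (n : nat) (a b : 'I_n -> R),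
      (forall i, [/\ I (a i), I (b i) & a i <= b i]) ->
      trivIset setT (fun i => `]a i, b i[%classic) ->
      \sum_(i < n) (b i - a i) < d ->
      \sum_(i < n) ComplexField.Normc.normc (f (b i) - f (a i)) < e.

(* R[i] carries its topology through the alias R[i]^o. *)
Definition S1 (R : realType) (f : R -> R[i]) : Prop :=
  [/\ periodic f 1,
      forall x : R, x \isn't a Num.int -> {for x, continuous (f : R -> R[i]^o)}
    & absolutely_continuous_on `]0, 1[ f].

Definition right_lim0 (R : realType) (f : R -> R[i]) : R[i] :=
  lim ((f x : R[i]^o) @[x --> (0 : R)^'+]).

Definition left_lim1 (R : realType) (f : R -> R[i]) : R[i] :=
  lim ((f x : R[i]^o) @[x --> (1 : R)^'-]).

(* derive1 is not available for R[i]-valued functions of a real variable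
   (R[i] is not equipped with a normed R-module structure); this is the same
   limit of difference quotients. *)
Definition cderive1 (R : realType) (f : R -> R[i]) (x : R) : R[i] :=
  lim (((h^-1)%:C * (f (h + x) - f x) : R[i]^o) @[h --> (0 : R)^']).

Definition cintegral (R : realType) (D : set R) (f : R -> R[i]) : R[i] :=
  (\int[lebesgue_measure]_(x in D) complex.Re (f x))%R +i*
  (\int[lebesgue_measure]_(x in D) complex.Im (f x))%R.

Definition dedekind_sum (R : realType) (r : nat) (f : 'I_r.+1 -> R -> R[i])
    (nu : 'I_r.+1 -> nat) (k : 'I_r.+1) : R[i] :=
  \sum_(1 <= i < nu k)
    \prod_(j < r.+1 | j != k) f j ((i * nu j)%:R / (nu k)%:R).

Definition jump (R : realType) (f : R -> R[i]) : R[i] := left_lim1 f - right_lim0 f.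

Definition jump_prod (R : realType) (r : nat) (f : 'I_r.+1 -> R -> R[i]) : R[i] :=
  \prod_(j < r.+1) left_lim1 (f j) - \prod_(j < r.+1) right_lim0 (f j).

Definition reciprocity (R : realType) (r : nat) (f : 'I_r.+1 -> R -> R[i])
    (nu : 'I_r.+1 -> nat) : R[i] :=
  \sum_(k < r.+1) dedekind_sum f nu k * jump (f k).

(* Main.v *)
Require Import Defs.
From HB Require Import structures.
From mathcomp Require Import all_boot all_order all_algebra.
From mathcomp Require Import complex.
From mathcomp Require Import all_classical all_reals all_analysis.
From mathcomp Require Import measurable_realfun.
From mathcomp Require Import ring lra.
Import Order.TTheory GRing.Theory Num.Theory.
Import numFieldNormedType.Exports.
Set Implicit Arguments.
Unset Strict Implicit.
Unset Printing Implicit Defensive.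
Local Open Scope classical_set_scope.
Local Open Scope ring_scope.
Local Open Scope complex_scope.

(** The function [H x = \prod_j f_j (nu_j x)] is absolutely continuous between
    consecutive points of the grid [m / N], [N = \prod_j nu_j], so integrating
    [H'] over [[0, 1]] gives [H(1^-) - H(0^+)] minus the jumps of [H] at the
    interior grid points.  By coprimality at most one factor jumps at such a
    point, the [k]-th one exactly at the [i / nu_k], and collecting these jumps
    yields the Dedekind sums.

    The fundamental theorem of calculus for an absolutely continuous [f] is
    obtained by writing [f] as the difference of its total variation [V] and
    [V - f]: both are nondecreasing and absolutely continuous, hence their
    Lebesgue-Stieltjes measures have Radon-Nikodym densities with respect to
    the Lebesgue measure, and Lebesgue's differentiation theorem identifies the
    densities with the derivatives almost everywhere. *)

(** * Absolutely continuous real functions *)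

Section continuity_complements.

Lemma cvg_comp_within {T U : topologicalType} (f : T -> U) (x : T)
    (P : set T) (Q : set U) :
  {for x, continuous f} -> P `<=` f @^-1` Q ->
  f @ within P (nbhs x) --> within Q (nbhs (f x)).
Proof.
move=> cf PQ A /cf QA; have {}QA : \forall y \near x, Q (f y) -> A (f y) by [].
by apply: filterS QA => y QAy /PQ /QAy.
Qed.

Context {R : realFieldType} {U : topologicalType}.
Implicit Types (f g : R -> U) (a b : R).

Lemma cvg_at_right_eq_in f g a b : a < b -> {in `]a, b[, f =1 g} ->
  {for a, continuous g} -> f x @[x --> a^'+] --> g a.
Proof.
move=> ab fg /cvg_at_right_filter; apply: cvg_trans; apply: near_eq_cvg.
near=> x; rewrite fg// in_itv/=; apply/andP; split.
- by near: x; exact: nbhs_right_gt.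
- by near: x; exact: nbhs_right_lt.
Unshelve. all: by end_near. Qed.

Lemma cvg_at_left_eq_in f g a b : a < b -> {in `]a, b[, f =1 g} ->
  {for b, continuous g} -> f x @[x --> b^'-] --> g b.
Proof.
move=> ab fg /cvg_at_left_filter; apply: cvg_trans; apply: near_eq_cvg.
near=> x; rewrite fg// in_itv/=; apply/andP; split.
- by near: x; exact: nbhs_left_gt.
- by near: x; exact: nbhs_left_lt.
Unshelve. all: by end_near. Qed.

End continuity_complements.

Section clamp.
Context {R : realFieldType}.
Implicit Types a b t x y : R.

Definition clamp a b x := Num.max a (Num.min b x).

Lemma clamp_homo a b : {homo clamp a b : x y / x <= y}.
Proof.
move=> x y xy.
by rewrite ge_max le_max lexx/= le_max le_min !ge_min lexx xy !orbT.
Qed.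

Lemma clamp_itv a b x : a <= b -> clamp a b x \in `[a, b].
Proof. by move=> ab; rewrite in_itv/= le_max lexx ge_max ab ge_min lexx. Qed.

Lemma clamp_id a b : {in `[a, b], clamp a b =1 id}.
Proof.
by move=> x; rewrite in_itv/= => /andP[? ?]; rewrite /clamp min_r ?max_r.
Qed.

Lemma clampB_le a b x y : x <= y -> clamp a b y - clamp a b x <= y - x.
Proof.
move=> xy; rewrite /clamp /Num.max /Num.min.
by case: (ltP b x) => bx; case: (ltP b y) => yb; do ?case: ifPn;
  rewrite -?leNgt => *; lra.
Qed.

Lemma clamp_shrink_itv a b t x : 0 < t -> t < (b - a) / 2 ->
  clamp (a + t) (b - t) x \in `]a, b[.
Proof.
move=> t0 tab; have atbt : a + t <= b - t by lra.
have := clamp_itv x atbt; rewrite !in_itv/= => /andP[? ?].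
by apply/andP; split; lra.
Qed.

Lemma clamp_shrink_dist a b x t t' :
  `|clamp (a + t) (b - t) x - clamp (a + t') (b - t') x| <= `|t - t'|.
Proof.
wlog tt' : t t' / t <= t'.
  move=> W; have [/W //|/ltW /W] := leP t t'.
  by rewrite distrC (distrC t').
rewrite (distrC t) (ger0_norm (_ : 0 <= t' - t)) ?subr_ge0//.
rewrite /clamp /Num.max /Num.min.
by case: (ltP (b - t) x) => bx; case: (ltP (b - t') x) => yb; do ?case: ifPn;
  rewrite -?leNgt => *; rewrite ler_norml; apply/andP; split; lra.
Qed.

End clamp.

Section absolute_continuity.
Context {R : realType}.
Implicit Types (I J : set R) (f g h phi : R -> R) (a b x y e d : R).

(* The families are indexed by arbitrary finite types, so that the points of
   subdivisions can later be indexed by a sigma type. *)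
Definition nonoverlapping I (T : finType) (x y : T -> R) :=
  (forall i, [/\ I (x i), I (y i) & x i <= y i]) /\
  trivIset setT (fun i => `]x i, y i[%classic).

(* The bound [e] is not strict, so that it passes to pointwise limits. *)
Definition ac_modulus I f e d :=
  forall (T : finType) (x y : T -> R), nonoverlapping I x y ->
    \sum_i (y i - x i) < d -> \sum_i `|f (y i) - f (x i)| <= e.

Definition abs_cont I f :=
  forall e, 0 < e -> exists2 d, 0 < d & ac_modulus I f e d.

Lemma nonoverlappingS I J (T : finType) (x y : T -> R) : I `<=` J ->
  nonoverlapping I x y -> nonoverlapping J x y.
Proof.
by move=> IJ [Ixy txy]; split=> // i; have [/IJ ? /IJ ? ?] := Ixy i.
Qed.

Lemma abs_contS I J f : I `<=` J -> abs_cont J f -> abs_cont I f.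
Proof.
move=> IJ acf e /acf[d d0 fed]; exists d => // T x y Ixy.
exact/fed/(nonoverlappingS IJ).
Qed.

Lemma eq_abs_cont I f g : {in I, f =1 g} -> abs_cont I f -> abs_cont I g.
Proof.
move=> fg acf e /acf[d d0 fed]; exists d => // T x y Ixy xyd.
rewrite (eq_bigr (fun i => `|f (y i) - f (x i)|)); first exact: fed.
by move=> i _; have [? ? _] := Ixy.1 i; rewrite !fg ?inE.
Qed.

Lemma abs_cont_dominated I f g h C : 0 <= C -> abs_cont I f -> abs_cont I g ->
  (forall x y, I x -> I y ->
    `|h y - h x| <= C * (`|f y - f x| + `|g y - g x|)) ->
  abs_cont I h.
Proof.
move=> C0 acf acg hfg e e0; have C1 : 0 < C + 1 by rewrite ltr_wpDl.
have e'0 : 0 < e / (2 * (C + 1)) by rewrite divr_gt0// mulr_gt0.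
have [d d0 fd] := acf _ e'0; have [d' d'0 gd'] := acg _ e'0.
exists (Num.min d d'); first by rewrite lt_min d0.
move=> T x y Ixy; rewrite lt_min.
move=> /andP[/(fd _ _ _ Ixy) fe /(gd' _ _ _ Ixy) ge].
apply: (@le_trans _ _ (C * (\sum_i `|f (y i) - f (x i)| +
                            \sum_i `|g (y i) - g (x i)|))).
  rewrite -big_split/= mulr_sumr ler_sum// => i _.
  by have [? ? _] := Ixy.1 i; exact: hfg.
rewrite (le_trans (ler_wpM2l C0 (lerD fe ge)))//.
have -> : C * (e / (2 * (C + 1)) + e / (2 * (C + 1))) = e * (C / (C + 1)).
  by field; rewrite gt_eqF.
by rewrite ler_piMr ?(ltW e0)// ler_pdivrMr// mul1r lerDl.
Qed.

Lemma abs_cont_cst I (c : R) : abs_cont I (cst c).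
Proof.
move=> e e0; exists 1 => // T x y _ _.
by rewrite big1 ?ltW// => i _; rewrite subrr normr0.
Qed.

Lemma abs_contB I f g : abs_cont I f -> abs_cont I g -> abs_cont I (f \- g).
Proof.
move=> acf acg; apply: (abs_cont_dominated ler01 acf acg) => x y _ _ /=.
have -> : f y - g y - (f x - g x) = (f y - f x) - (g y - g x) by ring.
by rewrite mul1r ler_normB.
Qed.

Lemma abs_contD I f g : abs_cont I f -> abs_cont I g -> abs_cont I (f \+ g).
Proof.
move=> acf acg; apply: (abs_cont_dominated ler01 acf acg) => x y _ _ /=.
by rewrite mul1r opprD addrACA ler_normD.
Qed.

Lemma abs_contM I f g M : (forall x, I x -> `|f x| <= M) ->
  (forall x, I x -> `|g x| <= M) ->
  abs_cont I f -> abs_cont I g -> abs_cont I (f \* g).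
Proof.
move=> fM gM acf acg.
apply: (@abs_cont_dominated _ f g _ `|M|) => //= x y Ix Iy.
have -> : f y * g y - f x * g x = (f y - f x) * g y + f x * (g y - g x) by ring.
rewrite (le_trans (ler_normD _ _))// !normrM mulrDr lerD//.
  by rewrite mulrC ler_wpM2r// (le_trans (gM _ Iy))// ler_norm.
by rewrite ler_wpM2r// (le_trans (fM _ Ix))// ler_norm.
Qed.

Lemma nonoverlapping_homo I J phi (T : finType) (x y : T -> R) :
  {homo phi : u v / u <= v} -> J `<=` phi @^-1` I ->
  nonoverlapping J x y -> nonoverlapping I (phi \o x) (phi \o y).
Proof.
move=> phi_homo JI [Jxy txy]; split.
  move=> i; have [? ? ?] := Jxy i.
  by split; [exact: JI|exact: JI|exact: phi_homo].
have reflect_lt u v : phi u < phi v -> u < v.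
  by apply: contraTT; rewrite -!leNgt => /phi_homo.
move=> i j _ _ [z [/=]]; rewrite !in_itv/= => /andP[xiz zyi] /andP[xjz zyj].
have /reflect_lt xyi := lt_trans xiz zyi.
have /reflect_lt xyj := lt_trans xjz zyj.
have /reflect_lt xiyj := lt_trans xiz zyj.
have /reflect_lt xjyi := lt_trans xjz zyi.
have mM : Num.max (x i) (x j) < Num.min (y i) (y j).
  by rewrite gt_max !lt_min xyi xyj xiyj xjyi.
have [mid_gt mid_lt] := (midf_lt mM); move: mid_gt mid_lt.
rewrite gt_max lt_min => /andP[? ?] /andP[? ?].
apply: txy => //; exists ((Num.max (x i) (x j) + Num.min (y i) (y j)) / 2).
by split; rewrite /= in_itv/=; apply/andP.
Qed.

Lemma ac_modulus_comp I J f phi e d k : 0 < k ->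
  {homo phi : x y / x <= y} -> J `<=` phi @^-1` I ->
  (forall x y, x <= y -> phi y - phi x <= k * (y - x)) ->
  ac_modulus I f e d -> ac_modulus J (f \o phi) e (d / k).
Proof.
move=> k0 phi_homo JI phik fed T x y Jxy xyd.
apply: (fed _ (phi \o x) (phi \o y)); first exact: nonoverlapping_homo Jxy.
move: xyd; rewrite ltr_pdivlMr// mulrC mulr_sumr; apply: le_lt_trans.
by apply: ler_sum => i _; have [_ _ /phik] := Jxy.1 i.
Qed.

Lemma abs_cont_comp I J f phi k : 0 < k ->
  {homo phi : x y / x <= y} -> J `<=` phi @^-1` I ->
  (forall x y, x <= y -> phi y - phi x <= k * (y - x)) ->
  abs_cont I f -> abs_cont J (f \o phi).
Proof.
move=> k0 phi_homo JI phik acf e /acf[d d0 fed]; exists (d / k).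
  exact: divr_gt0.
exact: (ac_modulus_comp k0 phi_homo JI phik fed).
Qed.

Lemma abs_cont_clamp a b f : a <= b -> abs_cont `[a, b] f ->
  abs_cont setT (f \o clamp a b).
Proof.
move=> ab; apply: (abs_cont_comp ltr01); first exact: clamp_homo.
  by move=> x _; exact: clamp_itv.
by move=> x y xy; rewrite mul1r clampB_le.
Qed.

Lemma ac_modulus_cvg {S : Type} {F : set_system S} {FF : ProperFilter F} I
    (f : S -> R -> R) g e d :
  (\forall s \near F, ac_modulus I (f s) e d) ->
  (forall x, I x -> f s x @[s --> F] --> g x) -> ac_modulus I g e d.
Proof.
move=> fed fg T x y Ixy xyd.
have fgT : \sum_i `|f s (y i) - f s (x i)| @[s --> F] -->
    \sum_i `|g (y i) - g (x i)|.
  apply: cvg_big => [|i _]; first exact: add_continuous.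
  by have [? ? _] := Ixy.1 i; apply: cvg_norm; apply: cvgB; exact: fg.
rewrite -(cvg_lim _ fgT)//; apply: limr_le; first exact: cvgP fgT.
by apply: filterS fed => s; exact.
Qed.

Lemma ac_modulus_dist I f e d x y : ac_modulus I f e d -> I x -> I y ->
  `|x - y| < d -> `|f x - f y| <= e.
Proof.
move=> fed; wlog xy : x y / x <= y.
  move=> W Ix Iy xyd; have [xy|/ltW yx] := leP x y; first exact: W.
  by rewrite distrC W// distrC.
move=> Ix Iy; rewrite distrC ger0_norm ?subr_ge0// => xyd.
have := fed unit (fun=> x) (fun=> y).
rewrite distrC !big_const !card_unit/= !addr0; apply => //.
by split=> [//|[] []].
Qed.

Lemma abs_cont_continuous f : abs_cont setT f -> continuous f.
Proof.
move=> acf x; apply/cvgrPdist_le => e /acf[d d0 fed].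
by near=> y; apply: (ac_modulus_dist fed) => //; near: y; exact: cvgr_dist_lt.
Unshelve. all: by end_near. Qed.

Lemma abs_cont_cvg_clamp a b f x : a < b -> abs_cont `]a, b[ f ->
  cvg (f (clamp (a + t) (b - t) x) @[t --> 0^'+]).
Proof.
move=> ab acf; apply: cauchy_cvg; apply: cauchy_exP => e e0.
have [d d0 fed] := acf _ (divr_gt0 e0 (ltr0n _ 2)).
pose m := Num.min d ((b - a) / 2).
have m0 : 0 < m by rewrite lt_min d0 divr_gt0// subr_gt0.
have md : m <= d by rewrite ge_min lexx.
have mab : m <= (b - a) / 2 by rewrite ge_min lexx orbT.
pose c t := clamp (a + t) (b - t) x; exists (f (c (m / 2))).
suff : \forall t \near 0^'+, ball (f (c (m / 2))) e (f (c t)) by [].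
near=> t.
have t0 : 0 < t by near: t; exact: nbhs_right_gt.
have tm : t < m / 2 by near: t; apply: nbhs_right_lt; rewrite divr_gt0.
rewrite /ball/= (@le_lt_trans _ _ (e / 2))//; last by lra.
apply: (ac_modulus_dist fed); [apply: clamp_shrink_itv; lra..|].
by rewrite (le_lt_trans (clamp_shrink_dist _ _ _ _ _))// gtr0_norm; lra.
Unshelve. all: by end_near. Qed.

(* The extension is the limit, as t tends to 0, of f precomposed with the
   projection onto [a + t, b - t]: these functions share a common modulus. *)
Lemma abs_cont_extension a b f : a < b -> abs_cont `]a, b[ f ->
  exists2 g, abs_cont setT g & {in `]a, b[, f =1 g}.
Proof.
move=> ab acf; pose c t := clamp (a + t) (b - t).
exists (fun x => lim (f (c t x) @[t --> 0^'+])) => [e /acf[d d0 fed]|x].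
  exists d => //; apply: (@ac_modulus_cvg R 0^'+ _ _ (fun t => f \o c t));
    last by move=> x _; exact: abs_cont_cvg_clamp acf.
  near=> t; rewrite -(divr1 d); apply: ac_modulus_comp fed => //.
  - exact: clamp_homo.
  - move=> x _; apply: clamp_shrink_itv; near: t; first exact: nbhs_right_gt.
    by apply: nbhs_right_lt; rewrite divr_gt0// subr_gt0.
  - by move=> x y xy; rewrite mul1r clampB_le.
rewrite in_itv/= => /andP[ax xb]; apply/esym/cvg_lim => //.
apply: cvg_near_cst; near=> t; congr f; apply: clamp_id; rewrite in_itv/=.
have tax : t < x - a by near: t; apply: nbhs_right_lt; rewrite subr_gt0.
have txb : t < b - x by near: t; apply: nbhs_right_lt; rewrite subr_gt0.
by apply/andP; split; lra.
Unshelve. all: by end_near. Qed.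

Lemma abs_cont_cvg_at_right a b f : a < b -> abs_cont `]a, b[ f ->
  cvg (f x @[x --> a^'+]).
Proof.
move=> ab /(abs_cont_extension ab)[g /abs_cont_continuous cg fg].
exact: cvgP (cvg_at_right_eq_in ab fg (cg a)).
Qed.

Lemma abs_cont_cvg_at_left a b f : a < b -> abs_cont `]a, b[ f ->
  cvg (f x @[x --> b^'-]).
Proof.
move=> ab /(abs_cont_extension ab)[g /abs_cont_continuous cg fg].
exact: cvgP (cvg_at_left_eq_in ab fg (cg b)).
Qed.

Lemma continuous_itv_bounded a b f : continuous f ->
  exists M, forall x, x \in `[a, b] -> `|f x| <= M.
Proof.
move=> cf; have /compact_bounded[M [_ fM]] : compact (f @` `[a, b]).
  apply: continuous_compact; last exact: segment_compact.
  exact: continuous_subspaceT.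
by exists (M + 1) => x xab; apply: (fM (M + 1)); [rewrite ltrDl|exists x].
Qed.

Lemma abs_cont_bounded a b f : a < b -> abs_cont `]a, b[ f ->
  exists M, forall x, x \in `]a, b[ -> `|f x| <= M.
Proof.
move=> ab /(abs_cont_extension ab)[g /abs_cont_continuous cg fg].
have [M gM] := continuous_itv_bounded a b cg; exists M => x xab.
by rewrite fg// gM// (subset_itv_oo_cc xab).
Qed.

End absolute_continuity.

(** * Total variation *)

Lemma itv_partition_nth_homo d (T : porderType d) (a b : T) s k l :
  itv_partition a b s -> (k <= l <= size s)%N ->
  (nth b (a :: s) k <= nth b (a :: s) l)%O.
Proof.
move=> [ps _] /andP[]; rewrite leq_eqVlt => /predU1P[-> //|kl ls].
apply/ltW/(sorted_ltn_nth lt_trans b (s := a :: s)) => //; rewrite inE/= ltnS//.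
exact/ltnW/(leq_trans kl).
Qed.

Section total_variation.
Context {R : realType}.
Implicit Types (I : set R) (f : R -> R) (a b x y z e d : R).

Section refinement.
Variables (I : set R) (T : finType) (x y : T -> R) (s : T -> seq R).
Hypothesis I_itv : is_interval I.
Hypothesis Ixy : nonoverlapping I x y.
Hypothesis s_partition : forall i, itv_partition (x i) (y i) (s i).

Let node i k := nth (y i) (x i :: s i) k.

Definition refine_left (t : {i & 'I_(size (s i))}) := node (tag t) (tagged t).
Definition refine_right (t : {i & 'I_(size (s i))}) :=
  node (tag t) (tagged t).+1.

Let node_homo i k l : (k <= l <= size (s i))%N -> node i k <= node i l.
Proof. exact: itv_partition_nth_homo. Qed.

Let node_itv i k : (k <= size (s i))%N -> x i <= node i k <= y i.
Proof. by move=> ks; rewrite itv_partition_nth_ge// itv_partition_nth_le. Qed.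

Lemma nonoverlapping_refine : nonoverlapping I refine_left refine_right.
Proof.
have I_node i k : (k <= size (s i))%N -> I (node i k).
  by have [Ix Iy _] := Ixy.1 i => /node_itv; exact: I_itv Ix Iy _.
split=> [[i j]|[i j] [i' j'] _ _ [z []]].
  split; [exact/I_node/ltnW|exact: I_node|].
  by apply: node_homo; rewrite leqnSn/=.
rewrite /= /refine_left /refine_right !in_itv/=.
move=> /andP[ijz zij] /andP[ij'z zij'].
have ii' : i = i'.
  have node_lt_itv l (k : 'I_(size (s l))) :
      node l k < z < node l k.+1 -> x l < z < y l.
    have /andP[xk _] := node_itv (ltnW (ltn_ord k)).
    have /andP[_ ky] := node_itv (ltn_ord k).
    by move=> /andP[/(le_lt_trans xk) -> /lt_le_trans/(_ ky) ->].
  apply: Ixy.2 => //; exists z; split; rewrite /= in_itv/=.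
    by apply: (node_lt_itv i j); rewrite ijz.
  by apply: (node_lt_itv i' j'); rewrite ij'z.
move: ii' j' ij'z zij' => <- j' ij'z zij'; congr existT; apply/val_inj/eqP.
have le_index (k l : 'I_(size (s i))) :
    node i k < z -> z < node i l.+1 -> (k <= l)%N.
  move=> kz zl; rewrite leqNgt; apply/negP => lk.
  have := lt_trans kz zl; rewrite ltNge => /negP; apply; apply: node_homo.
  by rewrite lk ltnW.
by rewrite eqn_leq !le_index.
Qed.

Lemma sum_refine_length :
  \sum_t (refine_right t - refine_left t) = \sum_i (y i - x i).
Proof.
rewrite (eq_bigr (fun i => \sum_(j < size (s i)) (node i j.+1 - node i j))).
  by rewrite sig_big_dep.
move=> i _; rewrite -(big_mkord xpredT (fun j => node i j.+1 - node i j)).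
by rewrite telescope_sumr// /node (itv_partition_nth_size _ (s_partition i)).
Qed.

Lemma sum_refine_variation f :
  \sum_t `|f (refine_right t) - f (refine_left t)| =
  \sum_i variation (x i) (y i) f (s i).
Proof.
rewrite (eq_bigr (fun i =>
  \sum_(j < size (s i)) `|f (node i j.+1) - f (node i j)|)).
  by rewrite sig_big_dep.
by move=> i _; rewrite /variation big_mkord.
Qed.

End refinement.

Lemma ac_modulus_variation I f e d (T : finType) (x y : T -> R)
    (s : T -> seq R) :
  is_interval I -> ac_modulus I f e d -> nonoverlapping I x y ->
  \sum_i (y i - x i) < d -> (forall i, itv_partition (x i) (y i) (s i)) ->
  \sum_i variation (x i) (y i) f (s i) <= e.
Proof.
move=> I_itv fed Ixy xyd xys; rewrite -sum_refine_variation.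
by apply: fed; [exact: nonoverlapping_refine|rewrite sum_refine_length].
Qed.

Lemma total_variation_seq a b f : a <= b -> exists s : nat -> seq R,
  (forall n, itv_partition a b (s n)) /\
  (variation a b f (s n))%:E @[n --> \oo] --> total_variation a b f.
Proof.
move=> ab; have [|u u_variation u_cvg] :=
    @ereal_sup_seq _ [set v%:E | v in variations a b f].
  apply/set0P/image_nonempty; have [->|/eqP ab'] := eqVneq a b.
    by exists 0; rewrite variationsxx.
  by apply: variations_neq0; rewrite lt_neqAle ab andbT; exact/eqP.
have /choice[s us] n :
    exists s, itv_partition a b s /\ u n = (variation a b f s)%:E.
  by have [_ [s abs <-] <-] := u_variation n; exists s.
exists s; split=> [n|]; first exact: (us n).1.
by under eq_fun do rewrite -(us _).2.
Qed.

Lemma ac_modulus_total_variation I f e d (T : finType) (x y : T -> R) :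
  is_interval I -> ac_modulus I f e d -> nonoverlapping I x y ->
  \sum_i (y i - x i) < d -> (\sum_i total_variation (x i) (y i) f <= e%:E)%E.
Proof.
move=> I_itv fed Ixy xyd.
have /choice[s sP] i :=
  total_variation_seq f (let: And3 _ _ xy := Ixy.1 i in xy).
have TV_cvg :
    (\sum_i (variation (x i) (y i) f (s i n))%:E)%E @[n --> \oo] -->
    (\sum_i total_variation (x i) (y i) f)%E.
  apply: cvg_nnesum => i _; last exact: (sP i).2.
  by apply: nearW => n; rewrite lee_fin variation_ge0.
apply: cvge_le TV_cvg; apply: nearW => n; rewrite sumEFin lee_fin.
by apply: (ac_modulus_variation I_itv fed Ixy xyd) => i; exact: (sP i).1.
Qed.

Lemma abs_cont_bounded_variation a b f : a <= b -> abs_cont `[a, b] f ->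
  bounded_variation a b f.
Proof.
move=> ab acf; have [d d0 fd] := acf _ ltr01.
have TV_short x y : a <= x -> x <= y -> y <= b -> y - x < d ->
    (total_variation x y f < +oo)%E.
  move=> ax xy yb xyd; apply: (@le_lt_trans _ _ 1%E); last by rewrite ltry.
  have := @ac_modulus_total_variation _ _ _ _ unit (fun=> x) (fun=> y)
    (@interval_is_interval R `[a, b]) fd.
  rewrite !big_const !card_unit/= addr0 adde0; apply=> //; split=> [_|[] []//].
  by rewrite /= !in_itv/= ax yb (le_trans ax xy) (le_trans xy yb).
have TV_steps n x : a <= x -> x <= b -> x - a < n%:R * (d / 2) ->
    (total_variation a x f < +oo)%E.
  elim: n x => [x ax _|n IH x ax xb xn].
    by rewrite mul0r subr_lt0 ltNge ax.
  have [xd|dx] := ltP (x - a) d; first exact: TV_short.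
  have axd : a <= x - d / 2 by lra.
  have xdx : x - d / 2 <= x by lra.
  rewrite (total_variationD _ axd xdx) lte_add_pinfty//.
    by apply: IH => //; [lra|move: xn; rewrite -natr1; lra].
  by apply: TV_short => //; lra.
apply/bounded_variationP => //; rewrite ge0_fin_numE ?total_variation_ge0//.
have d20 : 0 < d / 2 by rewrite divr_gt0.
apply: (TV_steps (Num.bound ((b - a) / (d / 2)))) => //.
by rewrite -ltr_pdivrMr// archi_boundP// divr_ge0 ?subr_ge0// ltW.
Qed.

Lemma abs_cont_total_variation_fin a b f x y : abs_cont `[a, b] f ->
  a <= x -> x <= y -> y <= b -> total_variation x y f \is a fin_num.
Proof.
move=> acf ax xy yb; apply/bounded_variationP => //.
apply: abs_cont_bounded_variation => //; apply: abs_contS acf => z /=.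
by rewrite !in_itv/= => /andP[/(le_trans ax) -> /le_trans ->].
Qed.

Lemma fine_total_variationB a b f x y : abs_cont `[a, b] f ->
  a <= x -> x <= y -> y <= b ->
  fine (total_variation a y f) - fine (total_variation a x f) =
  fine (total_variation x y f).
Proof.
move=> acf ax xy yb; have xb := le_trans xy yb.
rewrite (total_variationD _ ax xy) fineD; last 2 first.
- exact: abs_cont_total_variation_fin acf _ _ _.
- exact: abs_cont_total_variation_fin acf _ _ _.
by rewrite addrAC subrr add0r.
Qed.

Lemma abs_cont_total_variation a b f : abs_cont `[a, b] f ->
  abs_cont `[a, b] (fun x => fine (total_variation a x f)).
Proof.
move=> acf e /acf[d d0 fed]; exists d => // T x y Ixy xyd.
have xy_itv i : [/\ a <= x i, x i <= y i & y i <= b].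
  by have [] := Ixy.1 i; rewrite /= !in_itv/= => /andP[? ?] /andP[? ?].
have TV_fin i : total_variation (x i) (y i) f \is a fin_num.
  by have [? ? ?] := xy_itv i; exact: abs_cont_total_variation_fin acf _ _ _.
rewrite (eq_bigr (fun i => fine (total_variation (x i) (y i) f))); last first.
  move=> i _; have [? ? ?] := xy_itv i.
  rewrite (fine_total_variationB acf)// ger0_norm// fine_ge0//.
  exact: total_variation_ge0.
rewrite -lee_fin -sumEFin; under eq_bigr do rewrite fineK//.
apply: (ac_modulus_total_variation _ fed Ixy xyd).
exact: interval_is_interval.
Qed.

Lemma abs_cont_nondecreasingB a b f : abs_cont `[a, b] f -> exists g h,
  [/\ abs_cont `[a, b] g, {in `[a, b] &, nondecreasing_fun g},
      abs_cont `[a, b] h, {in `[a, b] &, nondecreasing_fun h} & f = g \- h].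
Proof.
move=> acf; pose V x := fine (total_variation a x f).
have acV : abs_cont `[a, b] V := abs_cont_total_variation acf.
exists V, (V \- f); split; [exact: acV| |exact: abs_contB| |].
- move=> x y; rewrite !in_itv/= => /andP[ax _] /andP[_ yb] xy.
  rewrite -subr_ge0 (fine_total_variationB acf)// fine_ge0//.
  exact: total_variation_ge0.
- move=> x y; rewrite !in_itv/= => /andP[ax _] /andP[_ yb] xy.
  suff : f y - f x <= V y - V x by rewrite /=; lra.
  rewrite (fine_total_variationB acf)// (le_trans (ler_norm _))//.
  rewrite -lee_fin fineK; first exact: total_variation_ge.
  exact: abs_cont_total_variation_fin acf _ _ _.
- by apply/funext => x /=; ring.
Qed.

End total_variation.

(** * The fundamental theorem of calculus *)

(* The library's hints for these filters do not fire on [lebesgue_measure]. *)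
#[local] Instance ae_lebesgue_filter (R : realType) :
  Filter (nbhs (almost_everywhere (@lebesgue_measure R))) :=
  ae_filter_ringOfSetsType _.

Section lebesgue_stieltjes_absolute_continuity.
Context {R : realType}.
Implicit Types (G : cumulative R R) (J U : set R) (x y e d : R).
Local Notation mu := (@lebesgue_measure R).

Lemma lebesgue_stieltjes_measure_itvoc G x y : x <= y ->
  lebesgue_stieltjes_measure G `]x, y] = (G y - G x)%:E.
Proof.
move=> xy; rewrite /lebesgue_stieltjes_measure /measure_extension.
by rewrite measurable_mu_extE/= ?wlength_itv_bnd//; exact: is_ocitv.
Qed.

Lemma lebesgue_measure_itv_bnd lx ry x y : x <= y ->
  mu [set` Interval (BSide lx x) (BSide ry y)] = (y - x)%:E.
Proof.
move=> xy; rewrite lebesgue_measure_itv/= lte_fin.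
by case: ltgtP xy => // ->; rewrite subrr.
Qed.

Lemma open_interval_finite_measure J : open J -> is_interval J ->
  (mu J < +oo)%E -> exists x y, x <= y /\ J = `]x, y[%classic.
Proof.
move=> oJ iJ muJ; have [->|/set0P[z Jz]] := eqVneq J set0.
  by exists 0, 0; rewrite set_itv_ge ?bnd_simp.
have muJ_fin : mu J \is a fin_num by rewrite ge0_fin_numE.
have dist_le u v : J u -> J v -> u <= v -> v - u <= fine (mu J).
  move=> Ju Jv uv; rewrite -lee_fin fineK//.
  rewrite -(lebesgue_measure_itv_bnd true false uv).
  by rewrite le_measure ?inE//; [exact: open_measurable|exact: iJ].
have lbJ : has_lbound J.
  exists (z - fine (mu J)) => w Jw; have [/(dist_le _ _ Jw Jz)|/ltW] := leP w z.
    by lra.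
  by have := fine_ge0 (measure_ge0 mu J); lra.
have ubJ : has_ubound J.
  exists (z + fine (mu J)) => w Jw; have [/(dist_le _ _ Jz Jw)|/ltW] := leP z w.
    by lra.
  by have := fine_ge0 (measure_ge0 mu J); lra.
have JE : J = `]inf J, sup J[%classic.
  by rewrite -[LHS]((interior_id J).1 oJ) interval_bounded_interior.
exists (inf J), (sup J); split=> //.
by rewrite (le_trans (ge_inf lbJ Jz))// ub_le_sup.
Qed.

Lemma open_finite_measure_itvoo U : open U -> (mu U < +oo)%E ->
  exists x y : nat -> R, [/\ forall q, x q <= y q,
    trivIset setT (fun q => `]x q, y q[%classic) &
    U = \bigcup_q `]x q, y q[%classic].
Proof.
move=> oU Uoo; pose J := open_disjoint_itv oU.
have UJ : U = \bigcup_q J q := open_disjoint_itv_bigcup oU.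
have J_itv q : exists xy : R * R, xy.1 <= xy.2 /\ J q = `]xy.1, xy.2[%classic.
  have oJ : open (J q) := @open_disjoint_itv_open _ _ oU q.
  have [||x [y [xy Jxy]]] := open_interval_finite_measure oJ.
  - exact: open_disjoint_itv_is_interval.
  - apply: le_lt_trans Uoo; rewrite le_measure ?inE//.
    + exact: open_measurable.
    + exact: open_measurable.
    + by rewrite UJ; exact: bigcup_sup.
  - by exists (x, y).
have /choice[xy xyP] := J_itv.
have JE : (fun q => `](xy q).1, (xy q).2[%classic) = J.
  by apply/funext => q; rewrite (xyP q).2.
exists (fun q => (xy q).1), (fun q => (xy q).2); rewrite JE; split=> // [q|].
  exact: (xyP q).1.
exact: open_disjoint_itv_trivIset.
Qed.

Lemma lebesgue_stieltjes_measure_open_le G e d U : ac_modulus setT G e d ->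
  open U -> (mu U < d%:E)%E -> (lebesgue_stieltjes_measure G U <= e%:E)%E.
Proof.
move=> Ged oU Ud.
have [x [y [xy tJ UJ]]] := open_finite_measure_itvoo oU (lt_trans Ud (ltry _)).
have mU : measurable U := open_measurable oU.
apply: (@le_trans _ _
    (\sum_(q <oo) lebesgue_stieltjes_measure G `]x q, y q]%classic)%E).
  apply: measure_sigma_subadditive => //.
  by rewrite UJ; apply: subset_bigcup => q _; exact: subset_itv_oo_oc.
apply: lime_le; first exact: is_cvg_nneseries.
apply: nearW => n; rewrite big_mkord.
under eq_bigr do rewrite lebesgue_stieltjes_measure_itvoc//.
rewrite sumEFin lee_fin.
apply: (@le_trans _ _ (\sum_(q < n) `|G (y q) - G (x q)|)).
  by apply: ler_sum => q _; exact: ler_norm.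
apply: Ged; first by split=> // i j _ _ ij; exact/val_inj/(tJ _ _ I I).
rewrite -lte_fin -sumEFin (le_lt_trans _ Ud)//.
rewrite (eq_bigr (fun q : 'I_n => mu `]x q, y q[%classic)); last first.
  by move=> q _; rewrite lebesgue_measure_itv_bnd.
rewrite -measure_bigsetU_ord; last 2 first.
- by move=> q; exact: measurable_itv.
- by move=> i j _ _ ij; exact/val_inj/(tJ _ _ I I).
rewrite le_measure ?inE//.
  by apply: bigsetU_measurable => q _; exact: measurable_itv.
rewrite UJ -(bigcup_mkord n (fun q => `]x q, y q[%classic)).
exact: bigcup_subset.
Qed.

Lemma lebesgue_stieltjes_measure_dominates G : abs_cont setT G ->
  lebesgue_stieltjes_measure G `<< (mu : set (measurableTypeR R) -> \bar R).
Proof.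
move=> acG; apply/null_content_dominatesP => A mA A0.
apply/eqP; rewrite eq_le measure_ge0 andbT.
apply/lee_addgt0Pr => e e0; rewrite add0e.
have [d d0 Ged] := acG _ e0.
have [|U [oU AU UA]] := lebesgue_regularity_outer mA _ d0.
  by rewrite [X in (X < _)%E]A0 ltry.
have mU : measurable U by exact: open_measurable.
apply: le_trans (lebesgue_stieltjes_measure_open_le Ged oU _).
  by rewrite le_measure ?inE.
rewrite -(setDUK AU) measureU//; [|exact: measurableD|by rewrite setDIK].
by rewrite [X in (X + _ < _)%E]A0 add0e.
Qed.

End lebesgue_stieltjes_absolute_continuity.

Lemma mfrestr_dominates d (T : measurableType d) (R : realType)
    (mu nu : {measure set T -> \bar R}) (D : set T) (mD : measurable D)
    (Dfin : (mu D < +oo)%E) :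
  mu `<< nu -> mfrestr mD Dfin `<< nu.
Proof.
move=> /null_content_dominatesP munu.
apply/null_content_dominatesP => A mA /(munu _ mA) muA0.
apply/eqP; rewrite eq_le measure_ge0 andbT -muA0 /mfrestr /mrestr.
by rewrite le_measure ?inE//; exact: measurableI.
Qed.

Section absolutely_continuous_primitive.
Context {R : realType}.
Implicit Types (f g : R -> R) (a b x y : R).
Local Notation mu := (@lebesgue_measure R).

Lemma nondecreasing_abs_cont_primitive a b f : a <= b -> abs_cont `[a, b] f ->
  {in `[a, b] &, nondecreasing_fun f} ->
  exists2 g, mu.-integrable setT (EFin \o g) & forall x, a <= x <= b ->
    f x - f a = \int[mu]_(t in `]a, x]) g t.
Proof.
move=> ab acf ndf; pose F := f \o clamp a b.
have acF : abs_cont setT F := abs_cont_clamp ab acf.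
have ndF : nondecreasing F.
  by move=> x y xy; apply: ndf; [exact: clamp_itv..|exact: clamp_homo].
have rcF x : F @ at_right x --> F x.
  by apply: cvg_at_right_filter; exact: (abs_cont_continuous acF).
pose G : cumulative R R := HB.pack F (isCumulative.Build R _ R F ndF rcF).
have FE x : a <= x <= b -> F x = f x.
  by move=> axb; rewrite /F/= clamp_id ?in_itv.
pose D : set (measurableTypeR R) := `]a, b]%classic.
have mD : measurable D by exact: measurable_itv.
have Dfin : (lebesgue_stieltjes_measure G D < +oo)%E.
  by rewrite lebesgue_stieltjes_measure_itvoc// ltry.
have G_dominated := @lebesgue_stieltjes_measure_dominates R G acF.
have [g [_ g_fin ig gE]] :=
  radon_nikodym_sigma_finite (mfrestr_dominates mD Dfin G_dominated).
have gK : EFin \o (fine \o g) = g by apply/funext => x /=; rewrite fineK.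
exists (fine \o g); first by rewrite gK.
move=> x /andP[ax xb].
suff xE : mfrestr mD Dfin `]a, x]%classic = (f x - f a)%:E.
  rewrite /Rintegral (eq_integral g) => [|t _]; last by rewrite /= fineK.
  by rewrite -gE; [exact: (congr1 fine (esym xE))|exact: measurable_itv].
rewrite /mfrestr /mrestr setIidl; last first.
  by move=> z; rewrite /D/= !in_itv/= => /andP[-> /le_trans]; apply.
by rewrite lebesgue_stieltjes_measure_itvoc//= !FE// ?lexx ?ab// ax xb.
Qed.

Lemma abs_cont_primitive a b f : a <= b -> abs_cont `[a, b] f ->
  exists2 g, mu.-integrable setT (EFin \o g) & forall x, a <= x <= b ->
    f x - f a = \int[mu]_(t in `]a, x]) g t.
Proof.
move=> ab /abs_cont_nondecreasingB[p [n [acp ndp acn ndn ->]]].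
have [gp igp gpE] := nondecreasing_abs_cont_primitive ab acp ndp.
have [gn ign gnE] := nondecreasing_abs_cont_primitive ab acn ndn.
exists (gp \- gn); first exact: (integrableB measurableT igp ign).
move=> x axb; rewrite RintegralB//=.
- by rewrite -gpE// -gnE//; ring.
- exact: integrableS igp.
- exact: integrableS ign.
Qed.

Lemma abs_cont_ftc a b f : a < b -> abs_cont `]a, b[ f ->
  exists2 g, mu.-integrable setT (EFin \o g) &
    {ae mu, forall x, a < x < b -> is_derive x 1 f (g x)} /\
    \int[mu]_(x in `]a, b]) g x =
    lim (f x @[x --> b^'-]) - lim (f x @[x --> a^'+]).
Proof.
move=> ab /(abs_cont_extension ab)[F acF fF].
have cF := abs_cont_continuous acF.
have [|g ig gE] := @abs_cont_primitive a b F (ltW ab).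
  exact: abs_contS acF.
exists g => //; split; last first.
  rewrite (cvg_lim _ (cvg_at_right_eq_in ab fF (cF a)))//.
  rewrite (cvg_lim _ (cvg_at_left_eq_in ab fF (cF b)))//.
  by rewrite -gE// lexx ltW.
have igy y : mu.-integrable [set` Interval (BRight a) (BRight y)] (EFin \o g).
  exact: integrableS ig.
have := FTC1 igy (open_integrable_locally openT ig).
apply: filterS => x + /andP[ax xb].
rewrite lte_fin => /(_ ax); set P := fun y : R => _ => -[dP Pg].
have {dP Pg}dP : is_derive x 1 P (g x).
  by apply: DeriveDef => //; rewrite -derive1E.
apply: (@near_eq_is_derive _ _ _ (P \+ cst (F a))).
  near=> y; have axb : a < y < b.
    by apply/andP; split; near: y; [exact: lt_nbhsr|exact: lt_nbhsl].
  rewrite /= /P -gE; first by rewrite subrK fF// in_itv.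
  by have /andP[/ltW -> /ltW] := axb.
by rewrite -[g x]addr0; exact: is_deriveD.
Unshelve. all: by end_near. Qed.

End absolutely_continuous_primitive.

(** * Integration up to null sets *)

Section integral_ae.
Local Open Scope ereal_scope.
Context d (T : measurableType d) (R : realType).
Variable mu : {measure set T -> \bar R}.
Import HBNNSimple.

(* No measurability is needed: the integral of a nonnegative function is a
   supremum over the simple functions below it, and those may be modified on
   a null set. *)
Lemma ge0_le_integral_ae (f g : T -> \bar R) : (forall x, 0 <= f x) ->
  (forall x, 0 <= g x) -> {ae mu, forall x, f x <= g x} ->
  \int[mu]_x f x <= \int[mu]_x g x.
Proof.
move=> f0 g0 [N [mN N0 fgN]]; rewrite !ge0_integralTE//.
apply: ge_ereal_sup => _ [h hf <-].
have mNC : measurable (~` N) by exact: measurableC.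
apply: (@le_trans _ _ (sintegral mu (proj_nnsfun h mNC))).
  rewrite -!integralT_nnsfun le_eqVlt; apply/orP; left; apply/eqP.
  apply: ae_eq_integral => //; [exact/measurable_EFinP..|].
  exists N; split => // x /=; apply: contra_notP => xN _.
  by rewrite mindicE mem_set// mulr1.
apply: ereal_sup_ubound; exists (proj_nnsfun h mNC) => //= x.
rewrite mindicE; have [|_] := boolP (x \in ~` N); last by rewrite mulr0.
rewrite inE mulr1 => xN; apply: le_trans (hf x) _.
by apply: contrapT => fgx; exact/xN/fgN.
Qed.

Lemma eq_integral_ae (f g : T -> \bar R) : {ae mu, forall x, f x = g x} ->
  \int[mu]_x f x = \int[mu]_x g x.
Proof.
have ge0_eq (f' g' : T -> \bar R) : (forall x, 0 <= f' x) ->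
    (forall x, 0 <= g' x) -> {ae mu, forall x, f' x = g' x} ->
    \int[mu]_x f' x = \int[mu]_x g' x.
  move=> f0 g0 fg; apply/eqP; rewrite eq_le !ge0_le_integral_ae//;
    by apply: filterS fg => x ->.
move=> fg; rewrite integralE [RHS]integralE; congr (_ - _); apply: ge0_eq.
- exact: funepos_ge0.
- exact: funepos_ge0.
- by apply: filterS fg => x E; rewrite !funeposE E.
- exact: funeneg_ge0.
- exact: funeneg_ge0.
- by apply: filterS fg => x E; rewrite !funenegE E.
Qed.

End integral_ae.

Section ae_integrable.
Context d (T : measurableType d) (R : realType).
Variable mu : {measure set T -> \bar R}.
Implicit Types (D A B : set T) (f g h : T -> R).

Lemma Rintegral_ae_eq D f g : f = g %[ae mu in D] ->
  \int[mu]_(x in D) f x = \int[mu]_(x in D) g x.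
Proof.
move=> fg; rewrite Rintegral_mkcond [RHS]Rintegral_mkcond; congr fine.
apply: eq_integral_ae; apply: filterS fg => x fgx.
by rewrite !patchE; case: ifPn => //; rewrite inE => /fgx ->.
Qed.

(* The derivative of an absolutely continuous function is only controlled off a
   null set and the Lebesgue measure is defined on the Borel sigma-algebra,
   which is not complete; hence the representative. *)
Definition ae_integrable D f :=
  exists2 g, mu.-integrable D (EFin \o g) & f = g %[ae mu in D].

Lemma integrable_ae_integrable D f : mu.-integrable D (EFin \o f) ->
  ae_integrable D f.
Proof. by exists f => //; exact: aeW. Qed.

Lemma eq_ae_integrable D f g : f = g %[ae mu in D] ->
  ae_integrable D f -> ae_integrable D g.
Proof.
move=> fg [h ih fh]; exists h => //.
by apply: filterS2 fg fh => x fgx fhx Dx; rewrite -fgx ?fhx.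
Qed.

Lemma ae_integrableD D f g : measurable D -> ae_integrable D f ->
  ae_integrable D g -> ae_integrable D (f \+ g).
Proof.
move=> mD [f' if' ff'] [g' ig' gg']; exists (f' \+ g').
  exact: (integrableD mD if' ig').
by apply: filterS2 ff' gg' => x ffx ggx Dx; rewrite /= ffx ?ggx.
Qed.

Lemma ae_RintegralD D f g : measurable D -> ae_integrable D f ->
  ae_integrable D g -> \int[mu]_(x in D) (f x + g x) =
  \int[mu]_(x in D) f x + \int[mu]_(x in D) g x.
Proof.
move=> mD [f' if' ff'] [g' ig' gg'].
rewrite (Rintegral_ae_eq ff') (Rintegral_ae_eq gg') -RintegralD//.
apply: Rintegral_ae_eq.
by apply: filterS2 ff' gg' => x ffx ggx Dx; rewrite /= ffx ?ggx.
Qed.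

Lemma ae_integrableZl D f (c : R) : measurable D -> ae_integrable D f ->
  ae_integrable D (fun x => c * f x).
Proof.
move=> mD [g ig fg]; exists (fun x => c * g x).
  exact: (integrableZl mD c ig).
by apply: filterS fg => x fgx Dx; rewrite fgx.
Qed.

Lemma ae_RintegralZl D f (c : R) : measurable D -> ae_integrable D f ->
  \int[mu]_(x in D) (c * f x) = c * \int[mu]_(x in D) f x.
Proof.
move=> mD [g ig fg]; rewrite (Rintegral_ae_eq fg) -RintegralZl//.
by apply: Rintegral_ae_eq; apply: filterS fg => x fgx Dx; rewrite fgx.
Qed.

Lemma ae_integrableB D f g : measurable D -> ae_integrable D f ->
  ae_integrable D g -> ae_integrable D (f \- g).
Proof.
move=> mD if_ ig; have := ae_integrableD mD if_ (ae_integrableZl (-1) mD ig).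
by apply: eq_ae_integrable; apply: aeW => x _ /=; rewrite mulN1r.
Qed.

Lemma ae_integrableM_bounded D f h M : measurable D -> ae_integrable D f ->
  measurable_fun D h -> (forall x, D x -> `|h x| <= M) ->
  ae_integrable D (f \* h).
Proof.
move=> mD [g ig fg] mh hM; exists (g \* h).
  apply: (integrableMl mD ig mh); exists M; split; first exact: num_real.
  by move=> r Mr x Dx; rewrite /= (le_trans (hM _ Dx))// ltW.
by apply: filterS fg => x fgx Dx; rewrite /= fgx.
Qed.

Lemma ae_integrableU A B f : measurable A -> measurable B -> [disjoint A & B] ->
  ae_integrable A f -> ae_integrable B f -> ae_integrable (A `|` B) f.
Proof.
move=> mA mB /disj_setPS AB [g ig fg] [h ih fh]; exists (g \_ A \+ h \_ B).
  have restrict_integrable D k : measurable D -> mu.-integrable D (EFin \o k) ->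
      mu.-integrable (A `|` B) (EFin \o (k \_ D)).
    move=> mD /(integrable_mkcond _ mD); rewrite restrict_EFin.
    by apply: integrableS => //; exact: measurableU.
  have iA := restrict_integrable _ _ mA ig.
  have iB := restrict_integrable _ _ mB ih.
  exact: (integrableD (measurableU _ _ mA mB) iA iB).
apply: filterS2 fg fh => x fgx fhx ABx; rewrite /= !patchE.
case: ifPn => [/set_mem Ax|/negP xA]; case: ifPn => [/set_mem Bx|/negP xB].
- by have := AB x (conj Ax Bx).
- by rewrite addr0 fgx.
- by rewrite add0r fhx.
- by case: ABx => /mem_set.
Qed.

Lemma ae_Rintegral_setU A B f : measurable A -> measurable B ->
  [disjoint A & B] -> ae_integrable A f -> ae_integrable B f ->
  \int[mu]_(x in A `|` B) f x =
  \int[mu]_(x in A) f x + \int[mu]_(x in B) f x.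
Proof.
move=> mA mB AB ifA ifB; have [g ig fg] := ae_integrableU mA mB AB ifA ifB.
rewrite (Rintegral_ae_eq fg) Rintegral_setU//; congr (_ + _);
  apply: Rintegral_ae_eq; apply: filterS fg => x fgx Dx; rewrite fgx//.
- by left.
- by right.
Qed.

End ae_integrable.

(** * Complex-valued functions *)

Section real_and_imaginary_parts.
Context {R : rcfType}.
Implicit Types (z w : R[i]) (c : R).
Local Notation Re := complex.Re.
Local Notation Im := complex.Im.

Lemma cReD z w : Re (z + w) = Re z + Re w.
Proof. by case: z w => ? ? []. Qed.

Lemma cImD z w : Im (z + w) = Im z + Im w.
Proof. by case: z w => ? ? []. Qed.

Lemma cReM z w : Re (z * w) = Re z * Re w - Im z * Im w.
Proof. by case: z w => ? ? []. Qed.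

Lemma cImM z w : Im (z * w) = Re z * Im w + Im z * Re w.
Proof. by case: z w => ? ? []. Qed.

Lemma cReZ c z : Re (c%:C * z) = c * Re z.
Proof. by rewrite cReM mul0r subr0. Qed.

Lemma cImZ c z : Im (c%:C * z) = c * Im z.
Proof. by rewrite cImM mul0r addr0. Qed.

End real_and_imaginary_parts.

Section complex_limits.
Context {R : realType}.
Implicit Types (F G : R -> R[i]) (a x k : R) (l m : R[i]).

Lemma cvg_real_complex {T : Type} {A : set_system T} {FA : Filter A}
    (f : T -> R) (l : R) : f x @[x --> A] --> l ->
  ((f x)%:C : R[i]^o) @[x --> A] --> (l%:C : R[i]^o).
Proof.
move=> fl; apply/cvgrPdist_lt => e; rewrite ltcE/= => /andP[/eqP ie re].
move/cvgrPdist_lt: fl => /(_ _ re); apply: filterS => x xl.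
rewrite -rmorphB normc_def/= expr0n addr0 sqrtr_sqr.
by rewrite ltcE/= ie eqxx.
Qed.

Lemma cvg_complex {T : Type} {A : set_system T} {FA : Filter A}
    (f : T -> R[i]) l : complex.Re (f x) @[x --> A] --> complex.Re l ->
  complex.Im (f x) @[x --> A] --> complex.Im l ->
  (f x : R[i]^o) @[x --> A] --> (l : R[i]^o).
Proof.
move=> /cvg_real_complex fr /cvg_real_complex fi.
rewrite [l]complexE (_ : (fun t => _) =
    (fun t => (complex.Re (f t))%:C + 'i%C * (complex.Im (f t))%:C)).
  apply: (@cvgD _ R[i]^o); first exact: fr.
  by apply: (@cvgM R[i]); [exact: cvg_cst|exact: fi].
by apply/funext => t; exact: complexE.
Qed.

Lemma complex_cvg_lim {T : Type} {A : set_system T} {FA : ProperFilter A}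
    (f : T -> R[i]) l : (f x : R[i]^o) @[x --> A] --> (l : R[i]^o) ->
  lim ((f x : R[i]^o) @[x --> A]) = l.
Proof.
by move=> fl; apply: (@cvg_lim R[i]^o); [exact: norm_hausdorff|exact: fl].
Qed.

Definition lim_at_right F a : R[i] := lim ((F x : R[i]^o) @[x --> a^'+]).
Definition lim_at_left F a : R[i] := lim ((F x : R[i]^o) @[x --> a^'-]).

Lemma lim_at_rightE F a l :
  (F x : R[i]^o) @[x --> a^'+] --> (l : R[i]^o) -> lim_at_right F a = l.
Proof. exact: complex_cvg_lim. Qed.

Lemma lim_at_leftE F a l :
  (F x : R[i]^o) @[x --> a^'-] --> (l : R[i]^o) -> lim_at_left F a = l.
Proof. exact: complex_cvg_lim. Qed.

Definition is_cderive F x l :=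
  ((h^-1)%:C * (F (h + x) - F x) : R[i]^o) @[h --> (0 : R)^'] --> (l : R[i]^o).

Lemma is_cderiveE F x l : is_cderive F x l -> cderive1 F x = l.
Proof. exact: complex_cvg_lim. Qed.

Lemma is_cderive_complex F x (r i : R) :
  is_derive x 1 (fun y => complex.Re (F y)) r ->
  is_derive x 1 (fun y => complex.Im (F y)) i -> is_cderive F x (r +i* i).
Proof.
have quotient_cvg (f : R -> R) s : is_derive x 1 f s ->
    h^-1 * (f (h + x) - f x) @[h --> 0^'] --> s.
  by move=> [df <-]; under eq_fun do rewrite -[X in f (X + x)]mulr1.
move=> /quotient_cvg dr /quotient_cvg di; apply: cvg_complex.
  by under eq_fun do rewrite cReZ cReD raddfN.
by under eq_fun do rewrite cImZ cImD raddfN.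
Qed.

Lemma is_cderive_continuous F x l : is_cderive F x l ->
  (F (h + x) : R[i]^o) @[h --> (0 : R)^'] --> (F x : R[i]^o).
Proof.
move=> dF.
have : ((F x + h%:C * ((h^-1)%:C * (F (h + x) - F x))) : R[i]^o)
    @[h --> (0 : R)^'] --> (F x + 0%:C * l : R[i]^o).
  apply: (@cvgD _ R[i]^o); first exact: cvg_cst.
  apply: (@cvgM R[i]) => //; apply: cvg_real_complex.
  by apply: cvg_within_filter; exact: cvg_id.
rewrite mul0r addr0; apply: cvg_trans; apply: near_eq_cvg; near=> h.
have h0 : h != 0 by near: h; exact: nbhs_dnbhs_neq.
by rewrite mulrA -rmorphM/= divff// mul1r subrKC.
Unshelve. all: by end_near. Qed.

Lemma is_cderiveM F G x l m : is_cderive F x l -> is_cderive G x m ->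
  is_cderive (F \* G) x (l * G x + F x * m).
Proof.
move=> dF dG; have cG := is_cderive_continuous dG.
rewrite /is_cderive (_ : (fun h => _) =
    (fun h => ((h^-1)%:C * (F (h + x) - F x)) * G (h + x) +
              F x * ((h^-1)%:C * (G (h + x) - G x)))).
  apply: (@cvgD _ R[i]^o); apply: (@cvgM R[i]).
  - exact: dF.
  - exact: cG.
  - exact: cvg_cst.
  - exact: dG.
by apply/funext => h /=; ring.
Qed.

Lemma is_cderive_prod (I : eqType) (s : seq I) (F : I -> R -> R[i])
    (l : I -> R[i]) x : uniq s -> (forall i, is_cderive (F i) x (l i)) ->
  is_cderive (fun y => \prod_(i <- s) F i y) x
    (\sum_(k <- s) l k * \prod_(j <- s | j != k) F j x).
Proof.
move=> + dF; elim: s => [_|i s IH /= /andP[iNs us]].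
  rewrite big_nil /is_cderive; under eq_fun do rewrite !big_nil subrr mulr0.
  exact: cvg_cst.
have -> : (fun y => \prod_(j <- i :: s) F j y) =
    F i \* (fun y => \prod_(j <- s) F j y).
  by apply/funext => y; rewrite big_cons.
have -> : \sum_(k <- i :: s) l k * \prod_(j <- i :: s | j != k) F j x =
    l i * \prod_(j <- s) F j x +
    F i x * \sum_(k <- s) l k * \prod_(j <- s | j != k) F j x.
  rewrite big_cons big_cons eqxx/= mulr_sumr; congr (_ * _ + _).
    rewrite big_seq_cond [RHS]big_seq; apply: eq_bigl => j.
    have [js|//] := boolP (j \in s); rewrite /=.
    by apply: contra iNs => /eqP <-.
  rewrite big_seq [RHS]big_seq; apply: eq_bigr => k ks.
  rewrite big_cons ifT; last by apply: contra iNs => /eqP ->.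
  by rewrite mulrCA.
by apply: is_cderiveM => //; exact: IH.
Qed.

Lemma is_cderive_scale F k x l : k != 0 ->
  is_cderive (fun y => F (k * y)) x l -> is_cderive F (k * x) ((k^-1)%:C * l).
Proof.
move=> k0 dF; have kV0 : h / k @[h --> (0 : R)^'] --> (0 : R)^'.
  rewrite -[X in _ --> X^'](mul0r k^-1).
  apply: cvg_comp_within; first by apply: cvgM; [exact: cvg_id|exact: cvg_cst].
  by move=> h h0; rewrite /= mul0r mulf_neq0// invr_neq0.
rewrite /is_cderive (_ : (fun h => _) = (fun h => (k^-1)%:C *
    (((h / k)^-1)%:C * (F (k * (h / k + x)) - F (k * x))))).
  by apply: (@cvgM R[i]); [exact: cvg_cst|exact: (cvg_comp _ _ kV0 dF)].
apply/funext => h; have -> : k * (h / k + x) = h + k * x by field.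
by rewrite [RHS]mulrA -rmorphM/= invf_div mulrA mulVf// mul1r.
Qed.

End complex_limits.

Section complex_absolute_continuity.
Context {R : realType}.
Implicit Types (F G : R -> R[i]) (D : set R) (phi : R -> R) (a b k : R).

Definition cabs_cont D F := abs_cont D (fun x => complex.Re (F x)) /\
  abs_cont D (fun x => complex.Im (F x)).

Lemma absolutely_continuous_on_cabs_cont D F :
  absolutely_continuous_on D F -> cabs_cont D F.
Proof.
have contraction_abs_cont (p : R[i] -> R) :
    (forall z z', p z - p z' = p (z - z')) ->
    (forall z, `|p z| <= ComplexField.Normc.normc z) ->
    absolutely_continuous_on D F -> abs_cont D (fun x => p (F x)).
  move=> pB p_le acF e /acF[d d0 Fd]; exists d => // T x y [Dxy txy].
  have enum_bij : {on predT, bijective (@enum_val T T)}.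
    by apply: onW_bij; exact: enum_val_bij.
  rewrite [ltLHS](reindex (@enum_val T T))//=.
  rewrite [leLHS](reindex (@enum_val T T))//=.
  move=> /(Fd #|T| (fun i => x (enum_val i)) (fun i => y (enum_val i))).
  move=> /(_ (fun=> Dxy _)) Fe; apply/ltW/le_lt_trans/Fe; last first.
    by move=> i j _ _ /txy => /(_ I I)/enum_val_inj.
  by apply: ler_sum => i _; rewrite pB.
move=> acF; split; apply: contraction_abs_cont acF.
- by move=> [? ?] [? ?].
- by move=> [u v] /=; rewrite -sqrtr_sqr ler_wsqrtr// lerDl sqr_ge0.
- by move=> [? ?] [? ?].
- by move=> [u v] /=; rewrite -sqrtr_sqr ler_wsqrtr// lerDr sqr_ge0.
Qed.

Lemma eq_cabs_cont D F G : {in D, F =1 G} -> cabs_cont D F -> cabs_cont D G.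
Proof.
by move=> FG [acr aci]; split; [apply: eq_abs_cont acr|apply: eq_abs_cont aci];
  move=> x /FG ->.
Qed.

Lemma cabs_cont_comp D E F phi k : 0 < k ->
  {homo phi : x y / x <= y} -> E `<=` phi @^-1` D ->
  (forall x y, x <= y -> phi y - phi x <= k * (y - x)) ->
  cabs_cont D F -> cabs_cont E (F \o phi).
Proof.
move=> k0 phi_homo ED phik [acr aci]; split.
  exact: (abs_cont_comp k0 phi_homo ED phik acr).
exact: (abs_cont_comp k0 phi_homo ED phik aci).
Qed.

Lemma cabs_contM a b F G : a < b -> cabs_cont `]a, b[ F ->
  cabs_cont `]a, b[ G -> cabs_cont `]a, b[ (F \* G).
Proof.
move=> ab [Fr Fi] [Gr Gi].
have acM f g : abs_cont `]a, b[ f -> abs_cont `]a, b[ g ->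
    abs_cont `]a, b[ (f \* g).
  move=> acf acg; have [M fM] := abs_cont_bounded ab acf.
  have [M' gM'] := abs_cont_bounded ab acg.
  by apply: (abs_contM (M := Num.max M M')) => // x xab;
    rewrite le_max ?fM ?gM' ?orbT.
split.
  apply: eq_abs_cont (abs_contB (acM _ _ Fr Gr) (acM _ _ Fi Gi)) => x _.
  by rewrite cReM.
apply: eq_abs_cont (abs_contD (acM _ _ Fr Gi) (acM _ _ Fi Gr)) => x _.
by rewrite cImM.
Qed.

Lemma cabs_cont_prod (I : Type) (s : seq I) (P : pred I) (F : I -> R -> R[i])
    a b : a < b -> (forall i, cabs_cont `]a, b[ (F i)) ->
  cabs_cont `]a, b[ (fun x => \prod_(i <- s | P i) F i x).
Proof.
move=> ab acF; elim: s => [|i s IH].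
  apply: (@eq_cabs_cont _ (fun=> 1)); first by move=> x _; rewrite big_nil.
  by split; exact: abs_cont_cst.
have [Pi|/negbTE Pi] := boolP (P i).
  by apply: eq_cabs_cont (cabs_contM ab (acF i) IH) => x _; rewrite big_cons Pi.
by apply: eq_cabs_cont IH => x _; rewrite big_cons Pi.
Qed.

Lemma cabs_cont_cvg_at_right a b F : a < b -> cabs_cont `]a, b[ F ->
  (F x : R[i]^o) @[x --> a^'+] -->
  (lim (complex.Re (F x) @[x --> a^'+]) +i*
   lim (complex.Im (F x) @[x --> a^'+]) : R[i]^o).
Proof.
by move=> ab [acr aci]; apply: cvg_complex; exact: abs_cont_cvg_at_right ab _.
Qed.

Lemma cabs_cont_cvg_at_left a b F : a < b -> cabs_cont `]a, b[ F ->
  (F x : R[i]^o) @[x --> b^'-] -->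
  (lim (complex.Re (F x) @[x --> b^'-]) +i*
   lim (complex.Im (F x) @[x --> b^'-]) : R[i]^o).
Proof.
by move=> ab [acr aci]; apply: cvg_complex; exact: abs_cont_cvg_at_left ab _.
Qed.

Lemma cabs_cont_cvg_lim_at_right a b F : a < b -> cabs_cont `]a, b[ F ->
  (F x : R[i]^o) @[x --> a^'+] --> (lim_at_right F a : R[i]^o).
Proof.
move=> ab /(cabs_cont_cvg_at_right ab) Fa.
by rewrite (lim_at_rightE Fa).
Qed.

Lemma cabs_cont_cvg_lim_at_left a b F : a < b -> cabs_cont `]a, b[ F ->
  (F x : R[i]^o) @[x --> b^'-] --> (lim_at_left F b : R[i]^o).
Proof.
move=> ab /(cabs_cont_cvg_at_left ab) Fb.
by rewrite (lim_at_leftE Fb).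
Qed.

End complex_absolute_continuity.

Section complex_integral.
Context {R : realType}.
Implicit Types (F G : R -> R[i]) (A B D : set R) (a b c : R).
Local Notation mu := (@lebesgue_measure R).

Definition cintegrable D F := ae_integrable mu D (fun x => complex.Re (F x)) /\
  ae_integrable mu D (fun x => complex.Im (F x)).

Lemma cintegral_ae_eq D F G : F = G %[ae mu in D] ->
  cintegral D F = cintegral D G.
Proof.
move=> FG; rewrite /cintegral; congr (_ +i* _); apply: Rintegral_ae_eq;
  by apply: filterS FG => x FGx /FGx ->.
Qed.

Lemma eq_cintegrable D F G : F = G %[ae mu in D] ->
  cintegrable D F -> cintegrable D G.
Proof.
move=> FG [iFr iFi]; split;
  [apply: eq_ae_integrable iFr|apply: eq_ae_integrable iFi];
  by apply: filterS FG => x FGx /FGx ->.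
Qed.

Lemma cintegrable0 D : measurable D -> cintegrable D (fun=> 0).
Proof.
by move=> mD; split; apply: integrable_ae_integrable; exact: integrable0.
Qed.

Lemma cintegrableD D F G : measurable D -> cintegrable D F -> cintegrable D G ->
  cintegrable D (F \+ G).
Proof.
move=> mD [iFr iFi] [iGr iGi]; split.
  by under eq_fun do rewrite cReD; exact: ae_integrableD.
by under eq_fun do rewrite cImD; exact: ae_integrableD.
Qed.

Lemma cintegralD D F G : measurable D -> cintegrable D F -> cintegrable D G ->
  cintegral D (F \+ G) = cintegral D F + cintegral D G.
Proof.
move=> mD [iFr iFi] [iGr iGi]; apply/eqP; rewrite eq_complex cReD cImD/=.
rewrite -!ae_RintegralD//; apply/andP.
split; apply/eqP; apply: eq_Rintegral => x _.
  by rewrite cReD.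
by rewrite cImD.
Qed.

Lemma cintegral0 D : cintegral D (fun=> 0) = 0.
Proof. by rewrite /cintegral /Rintegral integral0. Qed.

Lemma cintegrable_sum D (I : Type) (s : seq I) (F : I -> R -> R[i]) :
  measurable D -> (forall i, cintegrable D (F i)) ->
  cintegrable D (fun x => \sum_(i <- s) F i x).
Proof.
move=> mD iF; elim: s => [|i s IH].
  by under eq_fun do rewrite big_nil; exact: cintegrable0.
by under eq_fun do rewrite big_cons; exact: cintegrableD.
Qed.

Lemma cintegral_sum D (I : Type) (s : seq I) (F : I -> R -> R[i]) :
  measurable D -> (forall i, cintegrable D (F i)) ->
  cintegral D (fun x => \sum_(i <- s) F i x) = \sum_(i <- s) cintegral D (F i).
Proof.
move=> mD iF; elim: s => [|i s IH].
  by rewrite big_nil; under eq_fun do rewrite big_nil; exact: cintegral0.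
rewrite big_cons -IH; under eq_fun do rewrite big_cons.
by rewrite -cintegralD//; exact: cintegrable_sum.
Qed.

Lemma cintegrableZ D F c : measurable D -> cintegrable D F ->
  cintegrable D (fun x => c%:C * F x).
Proof.
move=> mD [iFr iFi]; split.
  by under eq_fun do rewrite cReZ; exact: ae_integrableZl.
by under eq_fun do rewrite cImZ; exact: ae_integrableZl.
Qed.

Lemma cintegralZ D F c : measurable D -> cintegrable D F ->
  cintegral D (fun x => c%:C * F x) = c%:C * cintegral D F.
Proof.
move=> mD [iFr iFi]; apply/eqP; rewrite eq_complex cReZ cImZ/=.
rewrite -!ae_RintegralZl//; apply/andP.
split; apply/eqP; apply: eq_Rintegral => x _.
  by rewrite cReZ.
by rewrite cImZ.
Qed.

Lemma cintegrableU A B F : measurable A -> measurable B -> [disjoint A & B] ->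
  cintegrable A F -> cintegrable B F -> cintegrable (A `|` B) F.
Proof. by move=> mA mB AB [? ?] [? ?]; split; exact: ae_integrableU. Qed.

Lemma cintegral_setU A B F : measurable A -> measurable B -> [disjoint A & B] ->
  cintegrable A F -> cintegrable B F ->
  cintegral (A `|` B) F = cintegral A F + cintegral B F.
Proof.
by move=> mA mB AB [? ?] [? ?]; rewrite /cintegral !ae_Rintegral_setU.
Qed.

Lemma cintegrable_itv_sum (p : nat -> R) n F :
  {homo p : i j / (i <= j)%N >-> i <= j} ->
  (forall m, cintegrable `]p m, p m.+1] F) ->
  cintegrable `]p 0%N, p n] F /\
  cintegral `]p 0%N, p n] F = \sum_(m < n) cintegral `]p m, p m.+1] F.
Proof.
move=> p_homo iF; elim: n => [|n [iFn IH]].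
  rewrite big_ord0 set_itv_ge ?bnd_simp ?ltxx//; split.
    by apply: eq_cintegrable (cintegrable0 measurable0); apply: aeW => x [].
  by rewrite /cintegral !Rintegral_set0.
have pU : `]p 0%N, p n.+1]%classic = `]p 0%N, p n] `|` `]p n, p n.+1].
  by rewrite -itv_bndbnd_setU// bnd_simp p_homo.
have p_disj : [disjoint `]p 0%N, p n]%classic & `]p n, p n.+1]%classic].
  apply/disj_setPS => x [/=]; rewrite !in_itv/= => /andP[_ xp] /andP[].
  by rewrite ltNge xp.
rewrite big_ord_recr/= -IH pU; split; first exact: cintegrableU.
by rewrite cintegral_setU.
Qed.

Lemma ae_neq c : {ae mu, forall x, x != c}.
Proof.
exists [set c]; split; [exact: measurable_set1|exact: lebesgue_measure_set1|].
by move=> x /= /negP/negPn/eqP.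
Qed.

Lemma ae_itvoo_itvoc a b (P : R -> Prop) :
  {ae mu, forall x, a < x < b -> P x} ->
  {ae mu, forall x, x \in `]a, b] -> P x}.
Proof.
move=> aeP; apply: filterS2 (ae_neq b) aeP => x xb Px.
by rewrite in_itv/= le_eqVlt (negbTE xb) => /Px.
Qed.

Lemma cintegral_itv_obnd_cbnd a (b : itv_bound R) F :
  cintegral [set` Interval (BRight a) b] F =
  cintegral [set` Interval (BLeft a) b] F.
Proof.
have itvE (f : R -> R) : \int[mu]_(x in [set` Interval (BRight a) b]) f x =
    \int[mu]_(x in [set` Interval (BLeft a) b]) f x.
  rewrite Rintegral_mkcond [RHS]Rintegral_mkcond; congr fine.
  apply: eq_integral_ae.
  apply: filterS (ae_neq a) => x xa; rewrite !patchE !mem_setE !itv_boundlr.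
  by rewrite !bnd_simp le_eqVlt eq_sym (negbTE xa).
by rewrite /cintegral !itvE.
Qed.

Lemma ae_integrableM_abs_cont a b (f h : R -> R) : a < b ->
  ae_integrable mu `]a, b] f -> abs_cont `]a, b[ h ->
  ae_integrable mu `]a, b] (f \* h).
Proof.
move=> ab iF /(abs_cont_extension ab)[g /abs_cont_continuous cg hg].
have [M gM] := continuous_itv_bounded a b cg.
suff : ae_integrable mu `]a, b] (f \* g).
  apply: eq_ae_integrable.
  by apply: ae_itvoo_itvoc; apply: aeW => x axb; rewrite /= hg ?in_itv.
apply: (ae_integrableM_bounded _ iF (M := M)) => //.
  by apply: measurable_funS (continuous_measurable_fun cg).
by move=> x xab; rewrite gM//; exact: subset_itv_oc_cc xab.
Qed.

Lemma cintegrableM_cabs_cont a b F G : a < b -> cintegrable `]a, b] F ->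
  cabs_cont `]a, b[ G -> cintegrable `]a, b] (fun x => F x * G x).
Proof.
move=> ab [iFr iFi] [acGr acGi]; split.
  under [X in ae_integrable _ _ X]eq_fun do rewrite cReM.
  by apply: ae_integrableB => //; exact: ae_integrableM_abs_cont.
under [X in ae_integrable _ _ X]eq_fun do rewrite cImM.
by apply: ae_integrableD => //; exact: ae_integrableM_abs_cont.
Qed.

Lemma cabs_cont_ftc a b F : a < b -> cabs_cont `]a, b[ F ->
  [/\ {ae mu, forall x, a < x < b -> is_cderive F x (cderive1 F x)},
      cintegrable `]a, b] (cderive1 F) &
      cintegral `]a, b] (cderive1 F) = lim_at_left F b - lim_at_right F a].
Proof.
move=> ab acF; have [/(abs_cont_ftc ab)[r ir [dr Ir]]] := acF.
move=> /(abs_cont_ftc ab)[i ii [di Ii]].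
have dF : {ae mu, forall x, a < x < b -> is_cderive F x (r x +i* i x)}.
  apply: filterS2 dr di => x dr di axb.
  exact: is_cderive_complex (dr axb) (di axb).
have dFE : (fun x => r x +i* i x) = cderive1 F %[ae mu in `]a, b]%classic].
  apply: ae_itvoo_itvoc; apply: filterS dF => x dF axb.
  by rewrite (is_cderiveE (dF axb)).
split.
- by apply: filterS dF => x dF /dF dFx; rewrite (is_cderiveE dFx).
- apply: eq_cintegrable dFE _; split; apply: integrable_ae_integrable.
    exact: integrableS ir.
  exact: integrableS ii.
- rewrite -(cintegral_ae_eq dFE) /cintegral/= Ir Ii.
  rewrite (lim_at_leftE (cabs_cont_cvg_at_left ab acF)).
  by rewrite (lim_at_rightE (cabs_cont_cvg_at_right ab acF)).
Qed.

Lemma cabs_cont_ftc_prod (I : finType) (F : I -> R -> R[i]) a b :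
  a < b -> (forall i, cabs_cont `]a, b[ (F i)) ->
  (forall k, cintegrable `]a, b]
    (fun x => cderive1 (F k) x * \prod_(j | j != k) F j x)) /\
  \sum_k cintegral `]a, b]
    (fun x => cderive1 (F k) x * \prod_(j | j != k) F j x) =
  \prod_k lim_at_left (F k) b - \prod_k lim_at_right (F k) a.
Proof.
move=> ab acF; pose H x := \prod_i F i x.
have acH : cabs_cont `]a, b[ H := cabs_cont_prod _ _ ab acF.
have term_integrable k : cintegrable `]a, b]
    (fun x => cderive1 (F k) x * \prod_(j | j != k) F j x).
  have [_ idF _] := cabs_cont_ftc ab (acF k).
  exact: cintegrableM_cabs_cont idF (cabs_cont_prod _ _ ab acF).
split=> //; have [dH _ IH] := cabs_cont_ftc ab acH.
have -> : \prod_k lim_at_left (F k) b = lim_at_left H b.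
  apply/esym/lim_at_leftE; apply: (@cvg_big R[i]^o) => [|i _].
    exact: (@mul_continuous R[i]).
  exact: cabs_cont_cvg_lim_at_left (acF i).
have -> : \prod_k lim_at_right (F k) a = lim_at_right H a.
  apply/esym/lim_at_rightE; apply: (@cvg_big R[i]^o) => [|i _].
    exact: (@mul_continuous R[i]).
  exact: cabs_cont_cvg_lim_at_right (acF i).
rewrite -IH -cintegral_sum//; apply: cintegral_ae_eq; apply: ae_itvoo_itvoc.
have dF : {ae mu, forall x, a < x < b ->
    forall k, is_cderive (F k) x (cderive1 (F k) x)}.
  have := @filter_forall _ _ _ _ (ae_lebesgue_filter R)
    (fun k => let: And3 dFk _ _ := cabs_cont_ftc ab (acF k) in dFk).
  by apply: filterS => x dFx axb k; exact: dFx.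
apply: filterS dF => x dFx /dFx{}dFx; apply/esym/is_cderiveE.
exact: (is_cderive_prod (index_enum_uniq I) dFx).
Qed.

End complex_integral.

(** * Jumps on the grid and Dedekind sums *)

Lemma coprime_mul_int (R : archiNumDomainType) (p q : nat) (x : R) :
  coprime p q ->
  p%:R * x \is a Num.int -> q%:R * x \is a Num.int -> x \is a Num.int.
Proof.
rewrite -[coprime p q]/(coprimez p q) => /coprimezP[[u v] /= uv1] px qx.
have -> : x = u%:~R * (p%:R * x) + v%:~R * (q%:R * x).
  by rewrite !mulrA -mulrDl !pmulrn -!intrM -intrD uv1 mul1r.
by rewrite rpredD// rpredM// intr_int.
Qed.

Lemma natr_div_int (R : archiNumFieldType) (m d : nat) : (0 < d)%N ->
  (m%:R / d%:R \is a (@Num.int R)) = (d %| m)%N.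
Proof.
move=> d0; have d0' : d%:R != 0 :> R by rewrite pnatr_eq0 -lt0n.
apply/idP/idP => [/intrP[z /(congr1 (fun y => y * d%:R))]|/dvdnP[q ->]].
  rewrite divfK// !pmulrn -intrM => /intr_inj mzd.
  by apply/(@dvdzP d m); exists z.
by rewrite natrM mulfK// intr_nat.
Qed.

Lemma big_nat_dvdn_mul (V : zmodType) (n d : nat) (F : nat -> V) : (0 < d)%N ->
  \sum_(1 <= m < n * d | (d %| m)%N) F m = \sum_(1 <= i < n) F (i * d)%N.
Proof.
case: n => [|n] d0; first by rewrite mul0n !big_geq.
apply: (@addrI _ (F 0%N)).
have -> : F 0%N + \sum_(1 <= m < n.+1 * d | (d %| m)%N) F m =
    \sum_(0 <= m < n.+1 * d | (d %| m)%N) F m.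
  by rewrite [RHS]big_ltn_cond ?muln_gt0// dvdn0.
rewrite -[F 0%N in RHS]/(F (0 * d)%N) -[RHS]big_ltn// big_mkcond big_nat_mul.
apply: eq_bigr => i _; rewrite big_ltn ?ltn_pmul2r// dvdn_mull//.
rewrite big_nat big1; first exact: addr0.
move=> m /andP[im mi]; rewrite ifF//; apply/negP => /dvdnP[q mq].
by move: im mi; rewrite mq !ltn_pmul2r// ltnS => iq qi; rewrite ltnNge qi in iq.
Qed.

Lemma sum_grid_int (R : archiNumFieldType) (V : zmodType) (n d : nat)
    (G : R -> V) :
  (0 < n)%N -> (0 < d)%N ->
  \sum_(1 <= m < n * d | n%:R * (m%:R / (n * d)%:R) \is a (@Num.int R))
     G (m%:R / (n * d)%:R) = \sum_(1 <= i < n) G (i%:R / n%:R).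
Proof.
move=> n0 d0; have [n0' d0'] : n%:R != 0 :> R /\ d%:R != 0 :> R.
  by rewrite !pnatr_eq0 -!lt0n.
under eq_bigl => m.
  have -> : n%:R * (m%:R / (n * d)%:R) = m%:R / d%:R :> R.
    by rewrite natrM; field; rewrite n0' d0'.
  rewrite natr_div_int//; over.
rewrite big_nat_dvdn_mul//; apply: eq_bigr => i _; congr G.
by rewrite !natrM; field; rewrite n0' d0'.
Qed.

Lemma sumrB_shift (V : zmodType) (n : nat) (F G : nat -> V) : (0 < n)%N ->
  \sum_(m < n) (F m.+1 - G m) =
  F n - G 0%N + \sum_(1 <= m < n) (F m - G m).
Proof.
case: n => // n _; rewrite -(big_mkord xpredT (fun m => F m.+1 - G m)) !sumrB.
rewrite big_nat_recr//= [X in _ - X]big_nat_recl//= !big_add1/=.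
by rewrite opprD [_ + F n.+1]addrC addrACA.
Qed.

Section one_sided_limits.
Context {R : realType}.
Implicit Types (F : R -> R[i]) (phi : R -> R) (a x : R) (l : R[i]).

Lemma lim_at_right_comp F phi a l : {for a, continuous phi} ->
  (forall x, a < x -> phi a < phi x) ->
  (F x : R[i]^o) @[x --> (phi a)^'+] --> (l : R[i]^o) ->
  lim_at_right (F \o phi) a = l.
Proof.
move=> cphi phi_lt Fl; apply: lim_at_rightE.
exact: (cvg_comp _ _ (cvg_comp_within cphi phi_lt) Fl).
Qed.

Lemma lim_at_left_comp F phi a l : {for a, continuous phi} ->
  (forall x, x < a -> phi x < phi a) ->
  (F x : R[i]^o) @[x --> (phi a)^'-] --> (l : R[i]^o) ->
  lim_at_left (F \o phi) a = l.
Proof.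
move=> cphi phi_lt Fl; apply: lim_at_leftE.
exact: (cvg_comp _ _ (cvg_comp_within cphi phi_lt) Fl).
Qed.

End one_sided_limits.

Section S1_limits.
Context {R : realType}.
Variable f : R -> R[i].
Hypothesis f_S1 : S1 f.
Implicit Types (a b k x : R) (z : int).

Lemma S1_periodicz z x : f (x + z%:~R) = f x.
Proof.
have [pf _ _] := f_S1; case: z => n; first by rewrite -pmulrn periodicn.
by rewrite NegzE rmorphN/= -pmulrn -[x in RHS](subrK n.+1%:R) (periodicn pf).
Qed.

Lemma S1_cabs_cont a b : (forall z, ~ (a < z%:~R < b)) -> cabs_cont `]a, b[ f.
Proof.
move=> no_int; have [_ _ /absolutely_continuous_on_cabs_cont acf] := f_S1.
pose z := Num.floor a.
apply: (@eq_cabs_cont _ _ (f \o (fun x => x + (- z)%:~R))).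
  by move=> x _; rewrite /= S1_periodicz.
apply: (cabs_cont_comp ltr01) acf => [x y xy|x|x y xy].
- by rewrite lerD2r.
- rewrite /= !in_itv/= rmorphN/= subr_gt0 ltrBlDr => /andP[ax xb].
  rewrite (le_lt_trans (floor_le a))//= (lt_le_trans xb)// leNgt.
  apply/negP => zb; apply: (no_int (z + 1)).
  by rewrite floorD1_gt rmorphD/= addrC.
- by rewrite mul1r; lra.
Qed.

Lemma S1_cabs_cont_scale a b k : 0 < k ->
  (forall z, ~ (k * a < z%:~R < k * b)) ->
  cabs_cont `]a, b[ (fun x => f (k * x)).
Proof.
move=> k0 /S1_cabs_cont; apply: (cabs_cont_comp k0) => [x y xy|x|x y xy].
- by rewrite ler_pM2l.
- by rewrite /= !in_itv/= !ltr_pM2l.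
- by rewrite mulrBr.
Qed.

Lemma S1_cvg_at_right x :
  (f y : R[i]^o) @[y --> x^'+] --> (lim_at_right f x : R[i]^o).
Proof.
apply: (@cabs_cont_cvg_lim_at_right _ _ (Num.floor x + 1)%:~R).
  exact: floorD1_gt.
apply: S1_cabs_cont => z; rewrite ltr_int ltzD1 -floor_lt_int ltNge.
by move=> /andP[/negP].
Qed.

Lemma S1_cvg_at_left x :
  (f y : R[i]^o) @[y --> x^'-] --> (lim_at_left f x : R[i]^o).
Proof.
apply: (@cabs_cont_cvg_lim_at_left _ (Num.ceil x - 1)%:~R).
  exact: ceilB1_lt.
apply: S1_cabs_cont => z; rewrite ltr_int ltrBlDr ltzD1 leNgt ceil_gt_int.
by move=> /andP[/negP].
Qed.

Lemma S1_lim_at_right_int x : x \is a Num.int ->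
  lim_at_right f x = right_lim0 f.
Proof.
move=> /intrP[z ->]; have shiftE : f \o (fun y => y + (- z)%:~R) = f.
  by apply/funext => y; rewrite /= S1_periodicz.
rewrite -[in LHS]shiftE; apply: lim_at_right_comp.
- by apply: cvgD; [exact: cvg_id|exact: cvg_cst].
- by move=> y zy; rewrite ltrD2r.
- by rewrite /= rmorphN/= subrr; exact: (@S1_cvg_at_right 0).
Qed.

Lemma S1_lim_at_left_int x : x \is a Num.int ->
  lim_at_left f x = left_lim1 f.
Proof.
move=> /intrP[z ->]; have shiftE : f \o (fun y => y + (1 - z)%:~R) = f.
  by apply/funext => y; rewrite /= S1_periodicz.
rewrite -[in LHS]shiftE; apply: lim_at_left_comp.
- by apply: cvgD; [exact: cvg_id|exact: cvg_cst].
- by move=> y zy; rewrite ltrD2r.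
- by rewrite /= rmorphB/= subrKC; exact: (@S1_cvg_at_left 1).
Qed.

Lemma S1_lim_at_right_nonint x : x \isn't a Num.int -> lim_at_right f x = f x.
Proof.
by have [_ cf _] := f_S1 => /cf cfx; exact/lim_at_rightE/cvg_at_right_filter.
Qed.

Lemma S1_lim_at_left_nonint x : x \isn't a Num.int -> lim_at_left f x = f x.
Proof.
by have [_ cf _] := f_S1 => /cf cfx; exact/lim_at_leftE/cvg_at_left_filter.
Qed.

Lemma S1_lim_at_right_scale k a : 0 < k ->
  lim_at_right (fun x => f (k * x)) a = lim_at_right f (k * a).
Proof.
move=> k0; apply: (@lim_at_right_comp _ _ ( *%R k)).
- by apply: cvgM; [exact: cvg_cst|exact: cvg_id].
- by move=> x; rewrite ltr_pM2l.
- exact: S1_cvg_at_right.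
Qed.

Lemma S1_lim_at_left_scale k a : 0 < k ->
  lim_at_left (fun x => f (k * x)) a = lim_at_left f (k * a).
Proof.
move=> k0; apply: (@lim_at_left_comp _ _ ( *%R k)).
- by apply: cvgM; [exact: cvg_cst|exact: cvg_id].
- by move=> x; rewrite ltr_pM2l.
- exact: S1_cvg_at_left.
Qed.

End S1_limits.

Lemma prod_S1_jump (R : realType) (I : finType) (f : I -> R -> R[i])
    (y : I -> R) :
  (forall j, S1 (f j)) ->
  (forall j k, j != k -> y j \is a Num.int -> y k \isn't a Num.int) ->
  \prod_j lim_at_left (f j) (y j) - \prod_j lim_at_right (f j) (y j) =
  \sum_(k | y k \is a Num.int) (\prod_(j | j != k) f j (y j)) * jump (f k).
Proof.
move=> f_S1 y_int.
have [k yk|y_nonint] := pickP (fun k => y k \is a Num.int); last first.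
  rewrite [RHS]big_pred0// (eq_bigr (fun j => f j (y j))) => [|j _]; last first.
    by rewrite S1_lim_at_left_nonint// y_nonint.
  rewrite [X in _ - X](eq_bigr (fun j => f j (y j))) ?subrr// => j _.
  by rewrite S1_lim_at_right_nonint// y_nonint.
have yj j : j != k -> y j \isn't a Num.int by rewrite eq_sym => /y_int; exact.
rewrite [RHS](big_pred1 k) => [|j]; last first.
  by apply/idP/eqP => [|->//]; apply: contraTeq => /yj.
rewrite (bigD1 k)//= S1_lim_at_left_int//.
rewrite [X in _ - X](bigD1 k)//= S1_lim_at_right_int//.
rewrite (eq_bigr (fun j => f j (y j))) => [|j /yj ?]; last first.
  by rewrite S1_lim_at_left_nonint.
rewrite [X in _ - _ * X](eq_bigr (fun j => f j (y j))) => [|j /yj ?].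
  by rewrite -mulrBl mulrC.
by rewrite S1_lim_at_right_nonint.
Qed.

Section reciprocity_on_grid.
Context {R : realType} (r : nat).
Variables (f : 'I_r.+1 -> R -> R[i]) (nu : 'I_r.+1 -> nat).
Hypothesis f_S1 : forall j, S1 (f j).
Hypothesis nu_gt0 : forall j, (0 < nu j)%N.

Definition grid m : R := m%:R / (\prod_j nu j)%:R.

Definition left_prod x := \prod_j lim_at_left (f j) ((nu j)%:R * x).

Definition right_prod x := \prod_j lim_at_right (f j) ((nu j)%:R * x).

Let integrand k x := cderive1 (f k) ((nu k)%:R * x) *
  \prod_(j < r.+1 | j != k) f j ((nu j)%:R * x).

Let N := (\prod_j nu j)%N.
Let nuR_gt0 j : 0 < (nu j)%:R :> R. Proof. by rewrite ltr0n. Qed.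
Let N_gt0 : (0 < N)%N. Proof. exact: prodn_gt0. Qed.
Let others_gt0 k : (0 < \prod_(j | j != k) nu j)%N.
Proof. by apply: prodn_cond_gt0. Qed.

Lemma grid_homo m n : (m <= n)%N -> grid m <= grid n.
Proof. by move=> mn; rewrite ler_pM2r ?invr_gt0 ?ltr0n// ler_nat. Qed.

Lemma grid_lt m : grid m < grid m.+1.
Proof. by rewrite ltr_pM2r ?invr_gt0 ?ltr0n// ltr_nat. Qed.

Lemma mul_gridE k m :
  (nu k)%:R * grid m = m%:R / (\prod_(j | j != k) nu j)%:R.
Proof.
rewrite /grid (bigD1 k)//= natrM; field.
by rewrite !pnatr_eq0 -!lt0n nu_gt0 others_gt0.
Qed.

Lemma grid_no_int k m (z : int) :
  ~ ((nu k)%:R * grid m < z%:~R < (nu k)%:R * grid m.+1).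
Proof.
rewrite !mul_gridE ltr_pdivrMr ?ltr0n// ltr_pdivlMr ?ltr0n// => /andP[].
by rewrite !pmulrn -intrM !ltr_int -(addn1 m) PoszD ltzD1 leNgt => ->.
Qed.

Lemma grid_piece m :
  (forall k, cintegrable `]grid m, grid m.+1] (integrand k)) /\
  \sum_k (nu k)%:R * cintegral `]grid m, grid m.+1] (integrand k) =
  left_prod (grid m.+1) - right_prod (grid m).
Proof.
pose F k x := f k ((nu k)%:R * x).
have acF k : cabs_cont `]grid m, grid m.+1[ (F k).
  by apply: S1_cabs_cont_scale => //; exact: grid_no_int.
have [iF IF] := cabs_cont_ftc_prod (grid_lt m) acF.
have integrandE k : (fun x => ((nu k)%:R^-1)%:C *
      (cderive1 (F k) x * \prod_(j | j != k) F j x)) = integrand k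
    %[ae lebesgue_measure in `]grid m, grid m.+1]%classic].
  have [dF _ _] := cabs_cont_ftc (grid_lt m) (acF k).
  apply: ae_itvoo_itvoc; apply: filterS dF => x dF /dF dFx.
  rewrite mulrA /integrand; congr (_ * _); apply/esym/is_cderiveE.
  by apply: is_cderive_scale dFx; rewrite gt_eqF.
split=> [k|].
  apply: eq_cintegrable (integrandE k) _; exact: cintegrableZ.
transitivity (\sum_k cintegral `]grid m, grid m.+1]
    (fun x => cderive1 (F k) x * \prod_(j | j != k) F j x)).
  apply: eq_bigr => k _; rewrite -(cintegral_ae_eq (integrandE k)) cintegralZ//.
  rewrite mulrA -(rmorph_nat (real_complex R)) -rmorphM divff ?mul1r//.
  by rewrite gt_eqF.
rewrite IF; congr (_ - _); apply: eq_bigr => k _.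
  exact: S1_lim_at_left_scale.
exact: S1_lim_at_right_scale.
Qed.

Lemma sum_cintegral_grid :
  \sum_k (nu k)%:R * cintegral `[0, 1] (integrand k) =
  \sum_(m < N) (left_prod (grid m.+1) - right_prod (grid m)).
Proof.
have cintegralE k : cintegral `[0, 1] (integrand k) =
    \sum_(m < N) cintegral `]grid m, grid m.+1] (integrand k).
  have [_ <-] := cintegrable_itv_sum N grid_homo (fun m => (grid_piece m).1 k).
  rewrite -cintegral_itv_obnd_cbnd /grid mul0r divff//.
  by rewrite pnatr_eq0 -lt0n N_gt0.
under eq_bigr do rewrite cintegralE mulr_sumr.
by rewrite exchange_big; apply: eq_bigr => m _; exact: (grid_piece m).2.
Qed.

Hypothesis nu_coprime : forall i j, i != j -> coprime (nu i) (nu j).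

Lemma grid_int_uniq m j k : (0 < m < N)%N -> j != k ->
  (nu j)%:R * grid m \is a Num.int -> (nu k)%:R * grid m \isn't a Num.int.
Proof.
move=> /andP[m0 mN] jk jm; apply/negP => km.
have : grid m \is a Num.int by exact: coprime_mul_int (nu_coprime jk) jm km.
by rewrite natr_div_int// => /(dvdn_leq m0); rewrite leqNgt mN.
Qed.

Lemma sum_grid_jump :
  \sum_(1 <= m < N) (left_prod (grid m) - right_prod (grid m)) =
  reciprocity f nu.
Proof.
rewrite big_nat; under eq_bigr => m mN.
  rewrite /left_prod /right_prod.
  rewrite (prod_S1_jump f_S1 (fun j k => @grid_int_uniq m j k mN)) big_mkcond.
  over.
rewrite -big_nat exchange_big/=; apply: eq_bigr => k _.
rewrite -big_mkcond/= -mulr_suml; congr (_ * _).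
pose G (x : R) := \prod_(j | j != k) f j ((nu j)%:R * x).
have N_split : (nu k * \prod_(j | j != k) nu j)%N = N.
  by rewrite /N [RHS](bigD1 k).
have := sum_grid_int G (nu_gt0 k) (others_gt0 k); rewrite N_split => sumG.
rewrite [LHS]sumG; apply: eq_bigr => i _; apply: eq_bigr => j _.
by congr (f j _); rewrite natrM mulrCA mulrA.
Qed.

Lemma sum_left_right_prod :
  \sum_(m < N) (left_prod (grid m.+1) - right_prod (grid m)) =
  jump_prod f + \sum_(1 <= m < N) (left_prod (grid m) - right_prod (grid m)).
Proof.
have left1 : left_prod (grid N) = \prod_j left_lim1 (f j).
  apply: eq_bigr => j _; rewrite S1_lim_at_left_int// /grid divff ?mulr1.
    exact: natr_int.
  by rewrite pnatr_eq0 -lt0n N_gt0.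
have right0 : right_prod (grid 0) = \prod_j right_lim0 (f j).
  by apply: eq_bigr => j _; rewrite /grid mul0r mulr0 S1_lim_at_right_int.
by rewrite /jump_prod -left1 -right0 -sumrB_shift.
Qed.

End reciprocity_on_grid.

Theorem theorem3p1 (R : realType) (r : nat) (f : 'I_r.+1 -> R -> R[i])
    (nu : 'I_r.+1 -> nat)
    (r_ge1 : (1 <= r)%N)
    (f_S1 : forall j, S1 (f j))
    (nu_gt0 : forall j, (0 < nu j)%N)
    (nu_distinct : forall i j, i != j -> nu i != nu j)
    (nu_coprime : forall i j, i != j -> coprime (nu i) (nu j)) :
  reciprocity f nu =
    - jump_prod f +
    \sum_(k < r.+1) (nu k)%:R *
      cintegral `[0, 1] (fun x : R =>
        cderive1 (f k) ((nu k)%:R * x) *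
        \prod_(j < r.+1 | j != k) f j ((nu j)%:R * x)).
Proof.
rewrite (sum_cintegral_grid f_S1 nu_gt0) sum_left_right_prod//.
by rewrite sum_grid_jump// addKr.
Qed.
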